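(* Let $K$ be a local field with ring of integers $\mathcal O$ and residue field of size $q$. Then there is an isometric isomorphism of $K$-Banach algebras $$K\langle X_0,X_1,\dots\rangle/I_q(K)\cong C(\mathcal O,K).$$
   Context: A local field is a field complete with respect to a nontrivial discrete nonarchimedean absolute value with finite residue field. $K\langle X_0,X_1,\dots\rangle$ is the set of formal power series $\sum_ia_i\underline X^i$ in countably many indeterminates $X_0,X_1,\dots$ with $a_i\to0$ (for each $\varepsilon>0$ only finitely many $|a_i|\ge\varepsilon$), a $K$-Banach algebra under the norm $\sup_i|a_i|$. $I_q(K)$ is the closure of the ideal generated by all $X_j^q-X_j$, and the quotient carries the residue norm $|f\bmod I|=\inf_{h\in I}|f+h|$. $C(\mathcal O,K)$ is the $K$-Banach algebra of continuous functions $\mathcal O\to K$ with the sup-norm and pointwise operations. *)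

(* Defs.v *)
From HB Require Import structures.
From mathcomp Require Import all_boot all_order all_algebra.
From mathcomp Require Import boolp classical_sets functions cardinality fsbigop reals.
Set Implicit Arguments. Unset Strict Implicit. Unset Printing Implicit Defensive.
Import Order.TTheory GRing.Theory Num.Theory.
Local Open Scope classical_set_scope.
Local Open Scope ring_scope.

Section LocalFieldDefs.
Variables (R : realType) (K : fieldType) (abs : K -> R).

Definition nonarch_abs : Prop :=
  (forall x, 0 <= abs x) /\ (forall x, abs x = 0 <-> x = 0) /\
  (forall x y, abs (x * y) = abs x * abs y) /\
  (forall x y, abs (x + y) <= Num.max (abs x) (abs y)).

Definition discrete_nontrivial : Prop :=
  exists pi : K, 0 < abs pi < 1 /\
    forall x, x != 0 -> exists n : int, abs x = (abs pi) ^ n.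

Definition abs_complete : Prop :=
  forall u : nat -> K,
    (forall e : R, 0 < e -> exists N, forall m n, (N <= m)%N -> (N <= n)%N ->
        abs (u m - u n) < e) ->
    exists l : K, forall e : R, 0 < e -> exists N, forall n, (N <= n)%N ->
        abs (u n - l) < e.

Definition intO : set K := [set x | abs x <= 1].

(** the residue field O / m (m = {|x| < 1}) has exactly q elements:
    q representatives in O, pairwise incongruent mod m, covering O mod m *)
Definition residue_card (q : nat) : Prop :=
  exists s : seq K,
    size s = q /\
    (forall i, (i < q)%N -> abs s`_i <= 1) /\
    (forall i j, (i < q)%N -> (j < q)%N -> abs (s`_i - s`_j) < 1 -> i = j) /\
    (forall x, abs x <= 1 -> exists2 i, (i < q)%N & abs (x - s`_i) < 1).

Definition local_field : Prop :=
  nonarch_abs /\ discrete_nontrivial /\ abs_complete /\ exists q, residue_card q.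

(** multi-indices: exponent vectors nat -> nat with finite support;
    a series is its coefficient function (extended by 0 outside
    finitely supported multi-indices). *)
Definition mono := nat -> nat.
Definition finsupp (i : mono) : Prop := exists n, forall k, (n <= k)%N -> i k = 0%N.

Definition tate (a : mono -> K) : Prop :=
  (forall i, ~ finsupp i -> a i = 0) /\
  (forall e : R, 0 < e -> finite_set [set i | e <= abs (a i)]).

Definition szero : mono -> K := fun _ => 0.
Definition sadd (a b : mono -> K) : mono -> K := fun i => a i + b i.
Definition sscale (c : K) (a : mono -> K) : mono -> K := fun i => c * a i.
Definition smul (a b : mono -> K) : mono -> K := fun i =>
  \sum_(p \in [set p : mono * mono | (fun k => (p.1 k + p.2 k)%N) = i])
     (a p.1 * b p.2).
Definition smono (m : mono) : mono -> K := fun i => if `[< i = m >] then 1 else 0.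
Definition sone : mono -> K := smono (fun _ => 0%N).
Definition svar (j : nat) : mono -> K := smono (fun k => nat_of_bool (k == j)).

Definition snorm (a : mono -> K) : R := sup [set abs (a i) | i in [set: mono]].

Definition gen_q (q : nat) (j : nat) : mono -> K :=
  sadd (iter q (smul (svar j)) sone) (sscale (-1) (svar j)).

Definition gen_ideal (q : nat) : set (mono -> K) :=
  [set f | exists (n : nat) (h : nat -> mono -> K) (js : nat -> nat),
     (forall k, (k < n)%N -> tate (h k)) /\
     f = \big[sadd/szero]_(k < n) smul (h k) (gen_q q (js k))].

Definition Iq (q : nat) : set (mono -> K) :=
  [set f | tate f /\ forall e : R, 0 < e ->
     exists2 g, gen_ideal q g & snorm (sadd f (sscale (-1) g)) < e].

Definition resnorm (I : set (mono -> K)) (f : mono -> K) : R :=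
  inf [set snorm (sadd f h) | h in I].

Definition contO (f : K -> K) : Prop :=
  forall x, abs x <= 1 -> forall e : R, 0 < e ->
    exists2 d : R, 0 < d & forall y, abs y <= 1 -> abs (y - x) < d ->
      abs (f y - f x) < e.

Definition supO (f : K -> K) : R := sup [set abs (f x) | x in intO].

End LocalFieldDefs.

(* Main.v *)
Require Import Defs.
From HB Require Import structures.
From mathcomp Require Import all_boot all_order all_algebra.
From mathcomp Require Import boolp classical_sets functions cardinality fsbigop reals.
From mathcomp Require Import ring lra zify.
Import Order.TTheory GRing.Theory Num.Theory.
Set Implicit Arguments. Unset Strict Implicit. Unset Printing Implicit Defensive.
Local Open Scope classical_set_scope.
Local Open Scope ring_scope.

(* The map sends X_j to the j-th Teichmueller digit d_j : O -> T, where T is the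
   set of roots of X^q - X; so a monomial X^i goes to the finite product of the
   d_j^(i_j), and X_j^q - X_j goes to 0.  Modulo the ideal every series can be
   approximated by a polynomial with exponents < q.  The values of such a
   polynomial on the digit tuples T^n determine its coefficients through a tensor
   power of the inverse Vandermonde matrix of T.  The determinant of that matrix
   has norm 1, since distinct elements of T stay distinct in the residue field, so
   the inverse has entries of norm <= 1: hence the coefficients are bounded by the
   sup norm of the image, which gives isometry and the kernel.  By the same inverse
   matrix every function of the first n digits is such a polynomial; continuous
   functions on O are uniform limits of functions of finitely many digits, and the
   polynomials approximating a given function converge coefficientwise by the norm
   bound, which gives surjectivity. *)

(** * Growth of geometric sequences of real numbers *)

Lemma bernoulli_exp (R : realType) (d : R) (n : nat) :
  0 <= d -> 1 + n%:R * d <= (1 + d) ^+ n.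
Proof.
move=> d0; elim: n => [|n IH]; first by rewrite mul0r addr0 expr0.
rewrite exprS -natr1 mulrDl mul1r.
have H : 0 <= (1 + d) ^+ n - (1 + n%:R * d) by rewrite subr_ge0.
have H2 : 0 <= n%:R * d :> R by rewrite mulr_ge0.
have H3 : 0 <= d * ((1 + d) ^+ n - (1 + n%:R * d)) by rewrite mulr_ge0.
have H4 : 0 <= d * (n%:R * d) by rewrite mulr_ge0.
rewrite mulrDl mul1r.
by move: H H2 H3 H4; set A := (1 + d) ^+ n; set B := n%:R * d; lra.
Qed.

(** With [x^-1 = 1 + d], Bernoulli's inequality makes [x^-1 ^+ n] exceed [e^-1]; the value [x = 0],
    which has no inverse, is treated apart. *)
Lemma geometric_small (R : realType) (x e : R) : 0 <= x -> x < 1 -> 0 < e ->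
  exists N, forall n, (N <= n)%N -> x ^+ n < e.
Proof.
move=> x0 x1 e0.
have [xe|xn0] := eqVneq x 0.
  by exists 1%N => -[|n] // _; rewrite xe expr0n.
have xp : 0 < x by rewrite lt_neqAle eq_sym xn0.
pose d := x^-1 - 1.
have d0 : 0 < d by rewrite subr_gt0 invf_gt1.
have [N HN] : exists N : nat, (e * d)^-1 < N%:R.
  by exists (Num.bound (e * d)^-1); apply: archi_boundP; rewrite invr_ge0 mulr_ge0 // ltW.
exists N => n Nn.
have xV : x = (1 + d)^-1 by rewrite addrC subrK invrK.
have p1 : 0 < 1 + d by rewrite addr_gt0.
rewrite xV exprVn invf_plt ?posrE ?exprn_gt0 //.
apply: (lt_le_trans _ (bernoulli_exp n (ltW d0))).
have H : e^-1 < N%:R * d by move: HN; rewrite invfM ltr_pdivrMr.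
apply: (lt_le_trans H); apply: (@le_trans _ _ (n%:R * d)).
  by rewrite ler_wpM2r ?ler_nat // ltW.
by rewrite lerDr.
Qed.

(** * Ultrametric absolute values *)

Section Ultrametric.
Variables (R : realType) (K : fieldType) (abs : K -> R).
Hypothesis absna : nonarch_abs abs.

Lemma abs_ge0 x : 0 <= abs x.
Proof. by case: absna. Qed.

Lemma absM x y : abs (x * y) = abs x * abs y.
Proof. by case: absna => _ [_ []]. Qed.

Lemma abs_eq0 x : abs x = 0 -> x = 0.
Proof. by case: absna => _ [/(_ x)[]]. Qed.

Lemma abs0 : abs 0 = 0.
Proof. by case: absna => _ [/(_ 0)[_ ->]]. Qed.

Lemma abs1 : abs 1 = 1.
Proof.
have := absM 1 1; rewrite mulr1 -{1}[abs 1]mulr1 => /mulfI -> //.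
by apply/eqP => /abs_eq0 /eqP; rewrite oner_eq0.
Qed.

Lemma absX x n : abs (x ^+ n) = abs x ^+ n.
Proof. by elim: n => [|n IH]; rewrite ?expr0 ?abs1 // !exprS absM IH. Qed.

(** Meant for [x = -1], whence [abs] is even. *)
Lemma abs_sqr1 x : x ^+ 2 = 1 -> abs x = 1.
Proof.
move=> h; have : abs x ^+ 2 = 1 by rewrite -absX h abs1.
by move/eqP; rewrite sqrp_eq1 ?abs_ge0 // => /eqP.
Qed.

Lemma absN x : abs (- x) = abs x.
Proof. by rewrite -mulN1r absM abs_sqr1 ?mul1r // sqrrN expr1n. Qed.

Lemma abs_sign n : abs ((-1) ^+ n) = 1.
Proof. by rewrite absX absN abs1 expr1n. Qed.

Lemma absBC x y : abs (x - y) = abs (y - x).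
Proof. by rewrite -absN opprB. Qed.

Lemma absV x : abs x^-1 = (abs x)^-1.
Proof.
have [->|x0] := eqVneq x 0; first by rewrite invr0 abs0 invr0.
have ax : abs x != 0 by apply: contra_neq x0; exact: abs_eq0.
by apply: (mulfI ax); rewrite -absM !divff // abs1.
Qed.

Lemma absD x y : abs (x + y) <= Num.max (abs x) (abs y).
Proof. by case: absna => _ [_ []]. Qed.

Lemma absD_le B x y : abs x <= B -> abs y <= B -> abs (x + y) <= B.
Proof. by move=> xB yB; apply: (le_trans (absD x y)); rewrite ge_max xB. Qed.

Lemma absD_lt B x y : abs x < B -> abs y < B -> abs (x + y) < B.
Proof. by move=> xB yB; apply: (le_lt_trans (absD x y)); rewrite gt_max xB. Qed.

Lemma absB_le B x y : abs x <= B -> abs y <= B -> abs (x - y) <= B.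
Proof. by move=> xB yB; apply: absD_le => //; rewrite absN. Qed.

Lemma absB_lt B x y : abs x < B -> abs y < B -> abs (x - y) < B.
Proof. by move=> xB yB; apply: absD_lt => //; rewrite absN. Qed.

Lemma abs_trans_le B y x z : abs (x - y) <= B -> abs (y - z) <= B -> abs (x - z) <= B.
Proof. by move=> xy yz; rewrite -(subrKA y x); apply: absD_le. Qed.

Lemma abs_trans_lt B y x z : abs (x - y) < B -> abs (y - z) < B -> abs (x - z) < B.
Proof. by move=> xy yz; rewrite -(subrKA y x); apply: absD_lt. Qed.

Lemma abs_near_le B x y : abs (x - y) <= B -> abs y <= B -> abs x <= B.
Proof. by move=> xy yB; rewrite -(subrK y x); apply: absD_le. Qed.

Lemma absM_le B x y : abs x <= 1 -> abs y <= B -> abs (x * y) <= B.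
Proof.
move=> x1 yB; rewrite absM -[B]mul1r.
by apply: ler_pM => //; apply: abs_ge0.
Qed.

Lemma absM_le1 x y : abs x <= 1 -> abs y <= 1 -> abs (x * y) <= 1.
Proof. exact: absM_le. Qed.

Lemma abs_sum_le (I : eqType) (r : seq I) (P : pred I) (F : I -> K) B : 0 <= B ->
  (forall i, i \in r -> P i -> abs (F i) <= B) -> abs (\sum_(i <- r | P i) F i) <= B.
Proof.
move=> B0 H; rewrite big_seq_cond; apply: (big_ind (fun x => abs x <= B)).
- by rewrite abs0.
- by move=> x y; apply: absD_le.
- by move=> i /andP[]; apply: H.
Qed.

Lemma abs_prod (I : Type) (r : seq I) (P : pred I) (F : I -> K) :
  abs (\prod_(i <- r | P i) F i) = \prod_(i <- r | P i) abs (F i).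
Proof.
by apply: (big_ind2 (fun x y => abs x = y)) => [|x a y b <- <-|//]; rewrite ?abs1 ?absM.
Qed.

Lemma abs_prod_le1 (I : Type) (r : seq I) (P : pred I) (F : I -> K) :
  (forall i, P i -> abs (F i) <= 1) -> abs (\prod_(i <- r | P i) F i) <= 1.
Proof.
move=> H; apply: (big_ind (fun x => abs x <= 1)); rewrite ?abs1 //.
by move=> x y; apply: absM_le1.
Qed.

Lemma absX_le1 x n : abs x <= 1 -> abs (x ^+ n) <= 1.
Proof. by move=> x1; rewrite absX exprn_ile1 // abs_ge0. Qed.

Lemma abs_eq_le x y : (forall e, 0 < e -> abs (x - y) <= e) -> x = y.
Proof.
move=> H; apply/eqP; rewrite -subr_eq0; apply/eqP/abs_eq0/eqP.
rewrite eq_le abs_ge0 andbT; apply/ler_addgt0Pl => e e0.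
by rewrite addr0 H.
Qed.

Lemma abs_detmx_le1 n (A : 'M[K]_n) : (forall i j, abs (A i j) <= 1) -> abs (\det A) <= 1.
Proof.
move=> H; apply: abs_sum_le => // s _ _; apply: absM_le1; first by rewrite abs_sign.
exact: abs_prod_le1.
Qed.

(** The inverse is the adjugate divided by a determinant of norm 1, and cofactors are signed
    determinants of integral matrices. *)
Lemma abs_invmx_le1 n (A : 'M[K]_n) i j :
  (forall i j, abs (A i j) <= 1) -> abs (\det A) = 1 -> abs (invmx A i j) <= 1.
Proof.
(* For a singular matrix [invmx A] is [A] itself, and [H] closes that case. *)
move=> H dA; rewrite /invmx; case: ifP => // _.
rewrite !mxE; apply: absM_le1; first by rewrite absV dA invr1.
rewrite /cofactor; apply: absM_le1; first by rewrite abs_sign.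
by apply: abs_detmx_le1 => k l; rewrite !mxE.
Qed.

(** * Cauchy sequences and limits *)

Hypothesis cpl : abs_complete abs.

Lemma cauchy_dist (u : nat -> K) e N : 
  (forall n, (N <= n)%N -> abs (u n.+1 - u n) <= e) ->
  forall n, (N <= n)%N -> abs (u n - u N) <= e.
Proof.
move=> H n /subnK <-; elim: (n - N)%N => [|k IH].
  by rewrite add0n subrr abs0; apply: le_trans (H N (leqnn _)); apply: abs_ge0.
by rewrite addSn; apply: (abs_trans_le _ IH); apply: H; rewrite leq_addl.
Qed.

(** In the ultrametric setting small consecutive differences already make a sequence Cauchy: by
    [cauchy_dist] a bound on single steps bounds the whole tail. *)
Lemma cauchy_succ (u : nat -> K) :
  (forall e, 0 < e -> exists N, forall n, (N <= n)%N -> abs (u n.+1 - u n) < e) ->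
  exists l, forall e, 0 < e -> exists N, forall n, (N <= n)%N -> abs (u n - l) < e.
Proof.
move=> H; apply: cpl => e e0; have e20 : 0 < e / 2 by rewrite divr_gt0.
have [N HN] := H _ e20; exists N => m n Nm Nn.
have HN' k : (N <= k)%N -> abs (u k - u N) <= e / 2.
  by apply: cauchy_dist => j /HN /ltW.
apply: (@le_lt_trans _ _ (e / 2)); last by rewrite ltr_pdivrMr // ltr_pMr // ltr1n.
by apply: (@abs_trans_le _ (u N)); [|rewrite absBC]; apply: HN'.
Qed.

Lemma lim_dist_le (u : nat -> K) l B x : 0 <= B ->
  (forall e, 0 < e -> exists N, forall n, (N <= n)%N -> abs (u n - l) < e) ->
  (exists N, forall n, (N <= n)%N -> abs (u n - x) <= B) -> abs (l - x) <= B.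
Proof.
move=> B0 ul [N HN]; apply/ler_addgt0Pl => e e0.
have [M HM] := ul _ e0.
apply: (@abs_trans_le _ (u (maxn M N))).
  by rewrite absBC; apply: (le_trans (ltW (HM _ (leq_maxl _ _)))); rewrite lerDl.
by apply: (le_trans (HN _ (leq_maxr _ _))); rewrite lerDr ltW.
Qed.

End Ultrametric.

(** * Teichmueller representatives *)

Section Teichmuller.
Variables (R : realType) (K : fieldType) (abs : K -> R).
Hypotheses (absna : nonarch_abs abs) (cpl : abs_complete abs).
Variables (q : nat) (s : 'I_q -> K).
Hypotheses (s_le1 : forall i, abs (s i) <= 1)
  (s_inj : forall i j, abs (s i - s j) < 1 -> i = j)
  (s_cov : forall x, abs x <= 1 -> exists i, abs (x - s i) < 1).

(* An isometry of O permutes the residue classes; multiplying or adding up the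
   representatives then gives Fermat's little theorem and q = 0 in the residue field. *)
Lemma residue_perm (h : K -> K) : (forall x, abs x <= 1 -> abs (h x) <= 1) ->
  (forall x y, abs (h x - h y) = abs (x - y)) ->
  exists2 f : 'I_q -> 'I_q, injective f & forall i, abs (h (s i) - s (f i)) < 1.
Proof.
move=> h1 hd.
have [f Hf] := choice (fun i => s_cov (h1 _ (s_le1 i))).
exists f => // i j fij; apply: s_inj; rewrite -hd.
by apply: (abs_trans_lt absna (Hf i)); rewrite fij absBC.
Qed.

(** Translation by 1 permutes the residue classes, so the small differences [s i + 1 - s (f i)] add
    up to exactly [q]. *)
Lemma abs_residue_card_lt1 : abs q%:R < 1.
Proof.
have [f finj Hf] : exists2 f : 'I_q -> 'I_q, injective f
    & forall i, abs (s i + 1 - s (f i)) < 1.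
  apply: (@residue_perm (fun x => x + 1)) => [x x1|x y].
    by apply: absD_le => //; rewrite abs1.
  by rewrite opprD addrACA subrr addr0.
have -> : q%:R = \sum_i (s i + 1 - s (f i)) :> K.
  rewrite sumrB big_split /= [X in _ - X](_ : _ = \sum_i s i); last first.
    by rewrite [RHS](reindex_inj finj).
  by rewrite addrAC subrr add0r sumr_const card_ord.
apply: (big_ind (fun x => abs x < 1)); first by rewrite abs0.
- by move=> x y; apply: absD_lt.
- by [].
Qed.

(** Multiplication by [a] permutes the classes and fixes the zero class [i0]; the products over the
    nonzero classes before and after are compared, and the common factor [S] of norm 1 is
    cancelled. *)
Lemma abs_fermat_unit a : abs a = 1 -> abs (a ^+ q.-1 - 1) < 1.
Proof.
move=> a1.
have [i0 Hi0] : exists i, abs (0 - s i) < 1 by apply: s_cov; rewrite abs0.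
rewrite sub0r absN // in Hi0.
have [f finj Hf] : exists2 f : 'I_q -> 'I_q, injective f
    & forall i, abs (a * s i - s (f i)) < 1.
  apply: (@residue_perm (fun x => a * x)) => [x x1|x y].
    by apply: absM_le1 => //; rewrite a1.
  by rewrite -mulrBr absM // a1 mul1r.
have fi0 : f i0 = i0.
  apply: s_inj; apply: absB_lt => //.
  have : abs (a * s i0 - (a * s i0 - s (f i0))) < 1.
    by apply: absB_lt => //; rewrite absM // a1 mul1r.
  by rewrite opprB addrC subrK.
pose S := \prod_(i | i != i0) s i.
have S1 : abs S = 1.
  rewrite abs_prod // big1 // => i ii0; apply/eqP; rewrite eq_le s_le1 leNgt /=.
  by apply: contra ii0 => si; apply/eqP/s_inj/absB_lt.
have fS : \prod_(i | i != i0) s (f i) = S.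
  rewrite [RHS](reindex_inj finj); apply: eq_bigl => i.
  by rewrite -{2}fi0 (inj_eq finj).
(* Factorwise congruence passes to products only together with integrality of both products, so the
   induction carries all three facts. *)
have : abs (\prod_(i | i != i0) (a * s i) - \prod_(i | i != i0) s (f i)) < 1.
  have : [/\ abs (\prod_(i | i != i0) (a * s i)) <= 1, abs (\prod_(i | i != i0) s (f i)) <= 1
      & abs (\prod_(i | i != i0) (a * s i) - \prod_(i | i != i0) s (f i)) < 1].
    apply: (big_ind2 (fun x y => [/\ abs x <= 1, abs y <= 1 & abs (x - y) < 1])).
    - by rewrite subrr abs0 // abs1.
    - move=> x y x' y' [x1 y1 xy] [x1' y1' xy']; split; try exact: absM_le1.
      have -> : x * x' - y * y' = x * (x' - y') + (x - y) * y' by ring.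
      apply: absD_lt => //; rewrite absM //.
        by apply: le_lt_trans xy'; rewrite ler_piMl // abs_ge0.
      by apply: le_lt_trans xy; rewrite ler_piMr // abs_ge0.
    - by move=> i _; split=> //; apply: absM_le1 => //; rewrite a1.
  by case.
rewrite fS big_split /= prodr_const cardC1 card_ord -/S.
have -> : a ^+ q.-1 * S - S = (a ^+ q.-1 - 1) * S by ring.
by rewrite absM // S1 mulr1.
Qed.

Lemma abs_fermat a : abs a <= 1 -> abs (a ^+ q - a) < 1.
Proof.
have q0 : (0 < q)%N.
  by have [] := s_cov (x := 0); [rewrite abs0|move=> i _; apply: leq_ltn_trans (ltn_ord i)].
rewrite le_eqVlt => /orP[/eqP a1|a1].
  have -> : a ^+ q - a = a * (a ^+ q.-1 - 1) by rewrite -(prednK q0) /= exprS; ring.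
  by rewrite absM // a1 mul1r abs_fermat_unit.
apply: absB_lt => //; rewrite absX // exprn_ilt1 ?abs_ge0 //.
by rewrite -lt0n q0.
Qed.

(** The cofactor of [x - y] in [x ^+ q - y ^+ q] is a sum of [q] terms, each congruent to
    [x ^+ q.-1] modulo [x - y]; hence it is [q * x ^+ q.-1] up to an error of norm at most [rho]. *)
Lemma abs_subXq rho x y : abs x <= 1 -> abs y <= 1 -> abs (x - y) <= rho ->
  abs q%:R <= rho -> abs (x ^+ q - y ^+ q) <= rho * abs (x - y).
Proof.
move=> x1 y1 xy qr; have r0 : 0 <= rho by apply: le_trans qr; apply: abs_ge0.
rewrite subrXX absM // mulrC ler_wpM2r ?abs_ge0 //.
rewrite -[X in abs X](subrK (q%:R * x ^+ q.-1)); apply: absD_le => //; last first.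
  by rewrite mulrC; apply: absM_le => //; apply: absX_le1.
have -> : q%:R * x ^+ q.-1 = \sum_(i < q) x ^+ q.-1.
  by rewrite sumr_const card_ord mulr_natl.
rewrite -sumrB; apply: abs_sum_le => // i _ _.
have -> : x ^+ q.-1 = x ^+ (q.-1 - i) * x ^+ i.
  by rewrite -exprD subnK //; have := ltn_ord i; lia.
rewrite -mulrBr; apply: absM_le => //; first exact: absX_le1.
rewrite subrXX mulrC; apply: absM_le => //; last by rewrite absBC.
by apply: abs_sum_le => // j _ _; apply: absM_le1 => //; apply: absX_le1.
Qed.

(** The root is the limit of [a ^+ (q ^ n)]: raising to the power [q] contracts the distance between
    consecutive terms. *)
Lemma teichmuller_lift a : abs a <= 1 -> exists2 t, t ^+ q = t & abs (t - a) < 1.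
Proof.
move=> a1.
(* The contraction ratio: it bounds both [q] and the first step of the sequence, and is below 1 by
   Fermat. *)
pose th := Num.max (abs q%:R) (abs (a ^+ q - a)).
have th1 : th < 1 by rewrite gt_max abs_residue_card_lt1 abs_fermat.
have qth : abs q%:R <= th by rewrite le_max lexx.
have th0 : 0 <= th by apply: le_trans qth; apply: abs_ge0.
pose u n := a ^+ (q ^ n).
have uS n : u n.+1 = u n ^+ q by rewrite /u expnSr exprM.
have u0 : u 0%N = a by rewrite /u expn0 expr1.
have u1 n : abs (u n) <= 1 by apply: absX_le1.
have ud n : abs (u n.+1 - u n) <= th ^+ n.+1.
  elim: n => [|n IH]; first by rewrite uS u0 expr1 le_max lexx orbT.
  rewrite uS [X in _ - X]uS exprS.
  apply: (@le_trans _ _ (th * abs (u n.+1 - u n))); last by rewrite ler_wpM2l.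
  apply: abs_subXq => //; apply: (le_trans IH).
  by rewrite exprS ler_piMr // exprn_ile1 // ltW.
have [t Ht] : exists l, forall e, 0 < e -> exists N, forall n, (N <= n)%N -> abs (u n - l) < e.
  apply: cauchy_succ => // e e0.
  have [N HN] := geometric_small th0 th1 e0.
  by exists N => n Nn; apply: (le_lt_trans (ud n)); apply: HN; apply: leqW.
have ta : abs (t - a) <= th.
  apply: (lim_dist_le absna th0 Ht); exists 0%N => n _.
  have := @cauchy_dist _ _ _ absna u th 0 _ n (leq0n _).
  rewrite u0; apply => k _; apply: (le_trans (ud k)).
  by rewrite exprS ler_piMr // exprn_ile1 // ltW.
have t1 : abs t <= 1.
  apply: (abs_near_le absna _ a1); apply: (le_trans ta); exact: ltW.
exists t; last exact: le_lt_trans th1.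
(* [u N.+1 = u N ^+ q] is close both to [t ^+ q] and to [t]. *)
apply: (abs_eq_le absna) => e e0.
have [N HN] := Ht _ e0.
apply: (@abs_trans_le _ _ _ absna _ (u N.+1)); last by apply/ltW/HN.
rewrite uS subrXX; rewrite mulrC; apply: absM_le => //; last by rewrite absBC //; apply/ltW/HN.
by apply: abs_sum_le => // j _ _; apply: absM_le1 => //; apply: absX_le1.
Qed.

End Teichmuller.

(** Each lift stays in the residue class of the representative it comes from, so the lifts again
    represent every class exactly once. *)
Lemma teichmuller_system (R : realType) (K : fieldType) (abs : K -> R) (q : nat) :
  nonarch_abs abs -> abs_complete abs -> residue_card abs q ->
  exists t : 'I_q -> K, [/\ forall i, t i ^+ q = t i, forall i, abs (t i) <= 1,
    forall i j, abs (t i - t j) < 1 -> i = j &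
    forall x, abs x <= 1 -> exists i, abs (x - t i) < 1].
Proof.
move=> absna cpl [s [_ [s1 [sinj scov]]]].
pose s' (i : 'I_q) := s`_i.
have s'1 i : abs (s' i) <= 1 by apply: s1.
have s'inj i j : abs (s' i - s' j) < 1 -> i = j 
  by move=> H; apply: val_inj; apply: sinj => //; apply: ltn_ord.
have s'cov x : abs x <= 1 -> exists i, abs (x - s' i) < 1.
  by move=> /scov [i iq H]; exists (Ordinal iq).
have H i : exists t, t ^+ q = t /\ abs (t - s' i) < 1.
  by have [t t1 t2] := teichmuller_lift absna cpl s'1 s'inj s'cov (s'1 i); exists t.
have [t Ht] := choice H; exists t; split=> [i|i|i j tij|x x1].
- by case: (Ht i).
- by apply: (abs_near_le absna _ (s'1 i)); apply/ltW; case: (Ht i).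
- apply: s'inj; apply: (abs_trans_lt absna (y := t i)).
    by rewrite absBC //; case: (Ht i).
  by apply: (abs_trans_lt absna tij); case: (Ht j).
- have [i xi] := s'cov x x1.
  by exists i; apply: (abs_trans_lt absna xi); rewrite absBC //; case: (Ht i).
Qed.

(** * Digit expansions *)

Definition monoD (i j : mono) : mono := fun k => (i k + j k)%N.

Section Digits.
Variables (R : realType) (K : fieldType) (abs : K -> R).
Hypotheses (absna : nonarch_abs abs) (cpl : abs_complete abs).
Variable pi : K.
Hypotheses (pi0 : pi != 0) (pi1 : abs pi < 1)
  (pi_max : forall x, abs x < 1 -> abs x <= abs pi).
Variables (q : nat) (t : 'I_q -> K) (rd : K -> 'I_q).
Hypotheses (t_le1 : forall i, abs (t i) <= 1)
  (t_inj : forall i j, abs (t i - t j) < 1 -> i = j)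
  (rdP : forall x, abs x <= 1 -> abs (x - t (rd x)) < 1).

(** Removes the leading term of the expansion of [x] in powers of [pi] with coefficients among the
    [t i], and divides by [pi]. *)
Definition digit_shift (x : K) : K := (x - t (rd x)) / pi.

Definition dig (n : nat) (x : K) : 'I_q := rd (iter n digit_shift x).

Lemma digS n x : dig n.+1 x = dig n (digit_shift x).
Proof. by rewrite /dig iterSr. Qed.

Lemma abs_pi_gt0 : 0 < abs pi.
Proof.
by rewrite lt_neqAle abs_ge0 // andbT eq_sym; apply: contra_neq pi0; apply: abs_eq0.
Qed.

Lemma abs_piX_le m n : (m <= n)%N -> abs pi ^+ n <= abs pi ^+ m.
Proof. by move=> mn; apply: ler_wiXn2l => //; [apply/ltW/abs_pi_gt0|apply: ltW]. Qed.

Lemma abs_div_pi x n : abs (x / pi) <= abs pi ^+ n = (abs x <= abs pi ^+ n.+1).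
Proof.
by rewrite absM // absV // ler_pdivrMr ?abs_pi_gt0 // exprSr.
Qed.

Lemma rd_eq x y : abs x <= 1 -> abs y <= 1 -> abs (x - y) < 1 -> rd x = rd y.
Proof.
move=> x1 y1 xy; apply: t_inj; apply: (abs_trans_lt absna (y := x)).
  by rewrite absBC // rdP.
exact: (abs_trans_lt absna xy (rdP y1)).
Qed.

(** Here [pi] has to be a uniformizer: norm below 1 must imply norm at most [abs pi]. *)
Lemma abs_digit_shift_le1 x : abs x <= 1 -> abs (digit_shift x) <= 1.
Proof.
move=> x1; have := abs_div_pi (x - t (rd x)) 0.
by rewrite expr0 expr1 /digit_shift => ->; apply/pi_max/rdP.
Qed.

(** Points at distance below 1 share the leading digit, and then the shift divides their distance by
    [abs pi]. With the converse [dig_close], fixing the first [n] digits is the same as fixing a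
    ball of radius [abs pi ^+ n]. *)
Lemma dig_agree n x y : abs x <= 1 -> abs y <= 1 -> abs (x - y) <= abs pi ^+ n ->
  forall k, (k < n)%N -> dig k x = dig k y.
Proof.
elim: n x y => // n IH x y x1 y1 xy k kn.
have rxy : rd x = rd y.
  apply: rd_eq => //; apply: (le_lt_trans xy).
  by apply: (le_lt_trans (abs_piX_le (ltn0Sn n))); rewrite expr1.
case: k kn => [|k] kn //; rewrite !digS.
apply: IH => //; try exact: abs_digit_shift_le1.
have -> : digit_shift x - digit_shift y = (x - y) / pi.
  by rewrite /digit_shift rxy; field.
by rewrite abs_div_pi.
Qed.

Lemma dig_close n x y : abs x <= 1 -> abs y <= 1 ->
  (forall k, (k < n)%N -> dig k x = dig k y) -> abs (x - y) <= abs pi ^+ n.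
Proof.
elim: n x y => [|n IH] x y x1 y1 H; first by rewrite expr0; apply: absB_le.
have rxy : rd x = rd y := H 0%N (ltn0Sn n).
rewrite -abs_div_pi.
have -> : (x - y) / pi = digit_shift x - digit_shift y.
  by rewrite /digit_shift rxy; field.
apply: IH => [||k kn]; try exact: abs_digit_shift_le1.
by rewrite -!digS; apply: H.
Qed.

(** The point is built from the last digit backwards as [t (tau 0) + pi * y]; with finitely many
    digits no limit is involved. *)
Lemma dig_exist n (tau : nat -> 'I_q) :
  exists2 x, abs x <= 1 & forall k, (k < n)%N -> dig k x = tau k.
Proof.
elim: n tau => [|n IH] tau; first by exists 0; rewrite ?abs0.
have [y y1 Hy] := IH (fun k => tau k.+1).
pose x := t (tau 0%N) + pi * y.
have py : abs (pi * y) < 1.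
  by rewrite absM //; apply: le_lt_trans pi1; rewrite ler_piMr ?abs_ge0.
have x1 : abs x <= 1 by apply: absD_le => //; apply: ltW.
have rx : rd x = tau 0%N.
  apply: t_inj; apply: (abs_trans_lt absna (y := x)); first by rewrite absBC // rdP.
  by rewrite /x addrAC subrr add0r.
exists x => // -[|k] kn //; rewrite digS.
have -> : digit_shift x = y by rewrite /digit_shift rx /x; field.
exact: Hy.
Qed.

Section UniformContinuity.
Variables (g : K -> K) (e : R).
Hypotheses (g_cont : contO abs g) (e0 : 0 < e).

(* Compactness of O by bisection: a ball that is not good contains one of its q
   sub-balls that is not good either, and the nested balls so obtained shrink to a
   point where g would be discontinuous. *)
Let good (c : K) (n : nat) := exists N, forall x y, abs x <= 1 -> abs y <= 1 ->
  abs (x - c) <= abs pi ^+ n -> abs (y - c) <= abs pi ^+ n ->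
  abs (x - y) <= abs pi ^+ N -> abs (g x - g y) < e.

Lemma bad_sub_ball c n : abs c <= 1 -> ~ good c n ->
  exists c', [/\ abs c' <= 1, abs (c' - c) <= abs pi ^+ n & ~ good c' n.+1].
Proof.
move=> c1 bad; apply: contrapT => H; apply: bad.
(* The centres of the [q] sub-balls of radius [abs pi ^+ n.+1]. *)
pose c' i := c + pi ^+ n * t i.
have Hc' i : abs (c' i - c) <= abs pi ^+ n.
  rewrite /c' addrAC subrr add0r absM // absX //.
  by rewrite ler_piMr // exprn_ge0 // abs_ge0.
have goods i : good (c' i) n.+1.
  have [//|nG] := pselect (good (c' i) n.+1).
  case: H; exists (c' i); split=> //.
  apply: (abs_near_le absna _ c1); apply: (le_trans (Hc' i)).
  by rewrite exprn_ile1 ?abs_ge0 // ltW.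
have [N HN] := choice goods.
(* The term [n.+1] forces [x] and [y] into the same sub-ball; the other one serves all [q] sub-balls
   at once. *)
exists (maxn n.+1 (\max_i N i)) => x y x1 y1 xc yc xy.
pose i := rd ((x - c) / pi ^+ n).
have pn0 : pi ^+ n != 0 by rewrite expf_neq0.
have xc' : abs (x - c' i) <= abs pi ^+ n.+1.
  have -> : x - c' i = pi ^+ n * ((x - c) / pi ^+ n - t i) by rewrite /c'; field.
  rewrite absM // absX // exprSr ler_wpM2l ?exprn_ge0 ?abs_ge0 //.
  apply/pi_max/rdP; rewrite absM // absV // ler_pdivrMr ?mul1r absX //.
  by rewrite exprn_gt0 // abs_pi_gt0.
apply: (HN i) => //.
  apply: (abs_trans_le absna _ xc'); rewrite absBC //; apply: (le_trans xy).
  by apply: abs_piX_le; apply: leq_maxl.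
apply: (le_trans xy); apply: abs_piX_le.
by apply: leq_trans (leq_maxr _ _); apply: leq_bigmax.
Qed.

Lemma contO_uniform : exists n, forall x y, abs x <= 1 -> abs y <= 1 ->
  (forall k, (k < n)%N -> dig k x = dig k y) -> abs (g x - g y) < e.
Proof.
(* The ball of radius [abs pi ^+ 0] around 0 is the whole of O. *)
have [[N HN]|bad0] := pselect (good 0 0).
  exists N => x y x1 y1 xy; apply: HN; rewrite ?subr0 ?expr0 //.
  by apply: (dig_close x1 y1).
have step (p : K * nat) : exists c', abs p.1 <= 1 -> ~ good p.1 p.2 ->
    [/\ abs c' <= 1, abs (c' - p.1) <= abs pi ^+ p.2 & ~ good c' p.2.+1].
  case: p => c n /=; have [H|H] := pselect (abs c <= 1 /\ ~ good c n).
    by have [c' Hc'] := bad_sub_ball H.1 H.2; exists c'.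
  by exists 0 => c1 nG; case: H.
have [F HF] := choice step.
pose c := fix c n := if n is m.+1 then F (c m, m) else 0.
have Hc n : abs (c n) <= 1 /\ ~ good (c n) n.
  elim: n => [|n [c1 cb]]; first by rewrite abs0.
  by have [] := HF (c n, n) c1 cb.
have cd n : abs (c n.+1 - c n) <= abs pi ^+ n.
  by have [c1 cb] := Hc n; have [] := HF (c n, n) c1 cb.
have [l Hl] : exists l, forall e, 0 < e -> exists N, forall n, (N <= n)%N -> abs (c n - l) < e.
  apply: cauchy_succ => // d d0.
  have [N HN] := geometric_small (abs_ge0 absna pi) pi1 d0.
  by exists N => n Nn; apply: (le_lt_trans (cd n)); apply: HN.
have lc n : abs (l - c n) <= abs pi ^+ n.
  apply: (lim_dist_le absna _ Hl); first by rewrite exprn_ge0 // abs_ge0.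
  exists n; apply: cauchy_dist => // m nm; apply: (le_trans (cd m)); exact: abs_piX_le.
have l1 : abs l <= 1.
  apply: (abs_near_le absna (y := c 0%N)); last by case: (Hc 0%N).
  by rewrite -[X in _ <= X](expr0 (abs pi)).
have [d d0 Hd] := g_cont l1 e0.
have [N HN] := geometric_small (abs_ge0 absna pi) pi1 d0.
(* The ball number [N] lies within [d] of [l], where [g] varies by less than [e]; so it is good with
   any modulus, in particular 0. *)
have [_] := Hc N; case; exists 0%N => x y x1 y1 xc yc _.
have near z : abs z <= 1 -> abs (z - c N) <= abs pi ^+ N -> abs (g z - g l) < e.
  move=> z1 zc; apply: Hd => //; apply: (le_lt_trans _ (HN N (leqnn N))).
  by apply: (abs_trans_le absna zc); rewrite absBC.
by apply: (abs_trans_lt absna (near x x1 xc)); rewrite absBC //; apply: near.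
Qed.

End UniformContinuity.

(** * Multi-indices and the values of monomials at the digits *)

Definition mono_bounded (n : nat) (i : mono) := forall k, (n <= k)%N -> i k = 0%N.

(* Junk value 0 when i has infinite support. *)
Definition mono_bound (i : mono) : nat := xget 0%N [set n | mono_bounded n i].

Lemma mono_boundP i : finsupp i -> mono_bounded (mono_bound i) i.
Proof. by move=> Hi; apply: (xgetPex 0%N Hi). Qed.

Lemma mono_boundedW m n i : (m <= n)%N -> mono_bounded m i -> mono_bounded n i.
Proof. by move=> mn H k nk; apply: H; apply: leq_trans nk. Qed.

Lemma finsuppD i j : finsupp i -> finsupp j -> finsupp (monoD i j).
Proof.
move=> [m Hm] [n Hn]; exists (maxn m n) => k; rewrite geq_max => /andP[mk nk].
by rewrite /monoD Hm // Hn.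
Qed.

Definition mon (x : K) (i : mono) : K := \prod_(k < mono_bound i) t (dig k x) ^+ i k.

Lemma mon_le1 x i : abs (mon x i) <= 1.
Proof. by apply: abs_prod_le1 => // k _; apply: absX_le1. Qed.

(** The bound chosen by [mono_bound] is immaterial, as a larger one only adds factors with exponent
    0. *)
Lemma monE n x i : mono_bounded n i -> mon x i = \prod_(k < n) t (dig k x) ^+ i k.
Proof.
move=> Hn; have Hb : mono_bounded (mono_bound i) i by apply: mono_boundP; exists n.
have wd a b : (a <= b)%N -> mono_bounded a i ->
    \prod_(k < b) t (dig k x) ^+ i k = \prod_(k < a) t (dig k x) ^+ i k.
  move=> ab Ha; rewrite -!(big_mkord xpredT (fun k => t (dig k x) ^+ i k)).
  rewrite (big_cat_nat (leq0n a) ab) /= [X in _ * X]big1_seq ?mulr1 // => k /andP[_].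
  by rewrite mem_index_iota => /andP[ak _]; rewrite Ha.
rewrite /mon; have [le|/ltnW le] := leqP (mono_bound i) n.
  by rewrite (wd _ _ le).
by rewrite (wd _ _ le).
Qed.

Lemma monD x i j : finsupp i -> finsupp j ->
  mon x (monoD i j) = mon x i * mon x j.
Proof.
move=> [m Hm] [n Hn]; have bi := mono_boundedW (leq_maxl m n) Hm.
have bj := mono_boundedW (leq_maxr m n) Hn.
rewrite !(@monE (maxn m n)) //; last by move=> k mk; rewrite /monoD bi // bj.
by rewrite -big_split; apply: eq_bigr => k _; rewrite exprD.
Qed.

Lemma mon0 x : mon x (fun=> 0%N) = 1.
Proof. by rewrite (@monE 0%N) // big_ord0. Qed.

Lemma mon_agree n x y i : mono_bounded n i ->
  (forall k, (k < n)%N -> dig k x = dig k y) -> mon x i = mon y i.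
Proof.
by move=> Hn H; rewrite !(monE _ Hn); apply: eq_bigr => k _; rewrite H.
Qed.

End Digits.

(** * The Tate algebra and its evaluations *)

Lemma inv_small (R : realType) (e : R) : 0 < e ->
  exists N, forall n, (N <= n)%N -> n.+1%:R^-1 < e.
Proof.
move=> e0; exists (Num.bound e^-1) => n Nn.
rewrite invf_plt ?posrE ?ltr0n //.
have := archi_boundP (ltW (etrans (invr_gt0 e) e0)); move/lt_le_trans; apply.
by rewrite ler_nat leqW.
Qed.

Definition ord_mono n (f : 'I_n -> nat) : mono :=
  fun j => if insub j is Some o then f o else 0%N.

Lemma ord_mono_bounded n (f : 'I_n -> nat) : mono_bounded n (ord_mono f).
Proof. by move=> k nk; rewrite /ord_mono insubN // -leqNgt. Qed.

Lemma ord_mono_ord n (f : 'I_n -> nat) (o : 'I_n) : ord_mono f o = f o.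
Proof. by rewrite /ord_mono valK. Qed.

Lemma ord_monoE n i : mono_bounded n i -> ord_mono (fun o : 'I_n => i o) = i.
Proof.
move=> bi; apply/funext => l; rewrite /ord_mono.
by case: insubP => [o _ ->//|]; rewrite -leqNgt => /bi.
Qed.

Section TateAlgebra.
Variables (R : realType) (K : fieldType) (abs : K -> R).
Hypothesis absna : nonarch_abs abs.

(** The terms common to [s] and [s'] cancel and all others are at most [e]: finite partial sums form
    a Cauchy net. *)
Lemma sum_approx (I : eqType) (u : I -> K) (s s' : seq I) e : uniq s -> uniq s' ->
  0 <= e -> (forall i, i \notin s -> abs (u i) <= e) ->
  (forall i, i \notin s' -> abs (u i) <= e) ->
  abs (\sum_(i <- s) u i - \sum_(i <- s') u i) <= e.
Proof.
move=> us us' e0 H H'.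
rewrite (bigID (mem s')) [X in _ - X](bigID (mem s)) /=.
have -> : \sum_(i <- s | i \in s') u i = \sum_(i <- s' | i \in s) u i.
  rewrite -big_filter -[RHS]big_filter; apply/perm_big/uniq_perm; rewrite ?filter_uniq //.
  by move=> i; rewrite !mem_filter andbC.
rewrite opprD addrACA subrr add0r; apply: absB_le => //; apply: abs_sum_le => // i _.
  exact: H'.
exact: H.
Qed.

Lemma tate_szero : tate abs (@szero K).
Proof.
split=> [//|e e0]; rewrite (_ : [set _ | _] = set0) ?finite_set0 //.
by apply/seteqP; split=> // i /=; rewrite abs0 // leNgt e0.
Qed.

Lemma tate_smono m : finsupp m -> tate abs (smono K m).
Proof.
move=> Hm; split=> [i Hi|e e0]; rewrite /smono.
  by case: asboolP => // im; case: Hi; rewrite im.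
apply: (@sub_finite_set _ _ [set m]) => [i /=|]; last exact: finite_set1.
by case: asboolP => //; rewrite abs0 // leNgt e0.
Qed.

Lemma tate_sadd f g : tate abs f -> tate abs g -> tate abs (sadd f g).
Proof.
move=> [f0 fS] [g0 gS]; split=> [i Hi|e e0]; rewrite /sadd.
  by rewrite f0 // g0 // addr0.
apply: (@sub_finite_set _ _ ([set i | e <= abs (f i)] `|` [set i | e <= abs (g i)])).
  move=> i /= H; have [|fi] := leP e (abs (f i)); [by left|right].
  by rewrite leNgt; apply: contraTN H => gi; rewrite -ltNge; apply: absD_lt.
by rewrite finite_setU; split; [apply: fS|apply: gS].
Qed.

Lemma tate_sscale c f : tate abs f -> tate abs (sscale c f).
Proof.
move=> [f0 fS]; split=> [i Hi|e e0]; rewrite /sscale; first by rewrite f0 // mulr0.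
have c0 : 0 < abs c + 1 by rewrite ltr_wpDl // abs_ge0.
apply: sub_finite_set (fS (e / (abs c + 1)) _); last by rewrite divr_gt0.
move=> i /= H; rewrite ler_pdivrMr //; apply: (le_trans H).
by rewrite absM // mulrC ler_wpM2l ?abs_ge0 // lerDl.
Qed.

Lemma tate_approx f e : tate abs f -> 0 < e -> exists s n, [/\ uniq s,
  forall i, i \notin s -> abs (f i) < e & forall i, i \in s -> mono_bounded n i].
Proof.
move=> [f0 fS] e0; have /finite_seqP[s Hs] := fS e e0.
have inE' i : (i \in s) = (e <= abs (f i)).
  by have := congr1 (fun A : set mono => A i) Hs => /= H; apply/idP/idP; rewrite H.
exists (undup s), (\max_(i <- s) mono_bound i)%N; split; first exact: undup_uniq.
  by move=> i; rewrite mem_undup inE' -ltNge.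
move=> i; rewrite mem_undup => si.
apply: (@mono_boundedW (mono_bound i)); first exact: leq_bigmax_seq.
(* A coefficient of norm at least [e] is nonzero, so its index has finite support. *)
apply: mono_boundP; apply: contrapT => /f0 fi.
by move: si; rewrite inE' fi abs0 // leNgt e0.
Qed.

Lemma tate_bounded f : tate abs f -> exists2 B, 1 <= B & forall i, abs (f i) <= B.
Proof.
move=> /tate_approx /(_ ltr01)[s [_ [us Hs _]]].
have S0 : 0 <= \sum_(i <- s) abs (f i) by apply: sumr_ge0 => i _; apply: abs_ge0.
exists (1 + \sum_(i <- s) abs (f i)) => [|i]; first by rewrite lerDl.
have [si|/Hs /ltW fi] := boolP (i \in s).
  rewrite (bigD1_seq i) //= addrCA lerDl addr_ge0 //.
  by apply: sumr_ge0 => j _; apply: abs_ge0.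
by apply: (le_trans fi); rewrite lerDl.
Qed.

(** The first summand determines the second, and it is given by [n] exponents, none above the
    largest exponent [M] of [k]. *)
Lemma finite_antidiagonal k : finsupp k ->
  finite_set [set p : mono * mono | monoD p.1 p.2 = k].
Proof.
move=> [n Hn]; pose M := (\max_(j < n) k j)%N.
pose phi (f : {ffun 'I_n -> 'I_M.+1}) : mono * mono :=
  
  let i := ord_mono (fun o => nat_of_ord (f o)) in (i, fun j => (k j - i j)%N).
apply: (@sub_finite_set _ _ [set phi f | f in [set: {ffun 'I_n -> 'I_M.+1}]]); last first.
  exact/finite_image/finite_finset.
move=> [i j] /= H; exists [ffun o : 'I_n => inord (i o)] => //.
have ij l : k l = (i l + j l)%N by rewrite -H.
have bi : mono_bounded n i.
  by move=> l /Hn /eqP; rewrite ij addn_eq0 => /andP[/eqP].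
have E : ord_mono (fun o => nat_of_ord ([ffun o : 'I_n => inord (i o) : 'I_M.+1] o)) = i.
  rewrite -[RHS](ord_monoE bi); congr ord_mono; apply/funext => o.
  rewrite ffunE inordK // ltnS; apply: (@leq_trans (k o)); first by rewrite ij leq_addr.
  exact: (leq_bigmax (F := fun j : 'I_n => k j)).
by rewrite /phi E; congr pair; apply/funext => l; rewrite ij addKn.
Qed.

Lemma smul_term0 f g k p : tate abs f -> tate abs g -> ~ finsupp k ->
  monoD p.1 p.2 = k -> f p.1 * g p.2 = 0.
Proof.
move=> [f0 _] [g0 _] nk pk.
have [H1|/f0->] := pselect (finsupp p.1); last by rewrite mul0r.
have [H2|/g0->] := pselect (finsupp p.2); last by rewrite mulr0.
by case: nk; rewrite -pk; apply: finsuppD.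
Qed.

(** Replaces the sum over all factorisations of [k] by a sum over a finite list, so that estimates
    of products need no knowledge of the actual support. *)
Lemma smul_approx f g (s : seq (mono * mono)) e k : tate abs f -> tate abs g ->
  uniq s -> 0 <= e ->
  (forall p, p \notin s -> monoD p.1 p.2 = k -> abs (f p.1 * g p.2) <= e) ->
  abs (smul f g k - \sum_(p <- s | monoD p.1 p.2 == k) f p.1 * g p.2) <= e.
Proof.
move=> tf tg us e0 H; rewrite /smul; set A := [set p | _].
(* A sum over a set with infinitely many nonzero terms would default to 0. For [k] of finite support
   there are finitely many factorisations; otherwise every term vanishes. *)
have finA : finite_set (A `&` (fun p => f p.1 * g p.2) @^-1` [set~ 0]).
  have [fk|nk] := pselect (finsupp k).
    exact/finite_setIl/finite_antidiagonal.
  rewrite (_ : _ `&` _ = set0) ?finite_set0 //.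
  by apply/seteqP; split=> // p [/= Ap]; case; apply: smul_term0 Ap.
pose u p := if monoD p.1 p.2 == k then f p.1 * g p.2 else 0.
rewrite (eq_big_seq u); last first.
  move=> p; rewrite in_finite_support // inE => -[/= Ap _].
  by rewrite /u -[X in X == _]/(fun l => (p.1 l + p.2 l)%N) Ap eqxx.
rewrite [X in _ - X]big_mkcond; apply: sum_approx => // [|p|p].
- exact: finite_support_uniq.
- rewrite in_finite_support // => pn; rewrite /u; case: eqP => [Ap|_]; last by rewrite abs0.
  suff -> : f p.1 * g p.2 = 0 by rewrite abs0.
  by apply: contraNP pn => np; rewrite inE.
- by move=> ps; rewrite /u; case: eqP => [Ap|_]; [apply: H|rewrite abs0].
Qed.

Lemma smul_bound f g e k : tate abs f -> tate abs g -> 0 <= e ->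
  (forall p, monoD p.1 p.2 = k -> abs (f p.1 * g p.2) <= e) -> abs (smul f g k) <= e.
Proof.
move=> tf tg e0 H; have := @smul_approx f g [::] e k tf tg isT e0.
by rewrite big_nil subr0; apply => p _; apply: H.
Qed.

Lemma smul_nfinsupp f g k : tate abs f -> tate abs g -> ~ finsupp k -> smul f g k = 0.
Proof.
move=> tf tg nk; apply: (abs_eq0 absna); apply/eqP; rewrite eq_le abs_ge0 // andbT.
by apply: smul_bound => // p /(smul_term0 tf tg nk) ->; rewrite abs0.
Qed.

Lemma tate_smul f g : tate abs f -> tate abs g -> tate abs (smul f g).
Proof.
move=> tf tg; split=> [i Hi|e e0]; first exact: smul_nfinsupp.
have [A A1 HA] := tate_bounded tf; have [B B1 HB] := tate_bounded tg.
have A0 : 0 < A by apply: lt_le_trans A1.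
have B0 : 0 < B by apply: lt_le_trans B1.
have [_ fS] := tf; have [_ gS] := tg.
have e20 : 0 < e / 2 by rewrite divr_gt0.
(* If [abs (smul f g k)] is at least [e], some term exceeds [e / 2], so its two factors exceed these
   thresholds; hence [k] is a sum of indices from two finite sets. *)
have fS' := fS (e / 2 / B) (divr_gt0 e20 B0).
have gS' := gS (e / 2 / A) (divr_gt0 e20 A0).
apply: sub_finite_set (finite_image (fun p => monoD p.1 p.2) (finite_setX fS' gS')).
move=> k /= ek; apply: contrapT => nk.
suff : abs (smul f g k) <= e / 2.
  by apply/negP; rewrite -ltNge; apply: lt_le_trans ek; lra.
apply: smul_bound => // [|p pk]; first exact: ltW.
rewrite leNgt; apply/negP => H; apply: nk; exists p => //; split=> /=.
  rewrite ler_pdivrMr //; apply: (le_trans (ltW H)); rewrite absM //.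
  by rewrite ler_wpM2l // abs_ge0.
rewrite ler_pdivrMr //; apply: (le_trans (ltW H)); rewrite absM // mulrC.
by rewrite ler_wpM2l // abs_ge0.
Qed.

Lemma smul_smono m n : finsupp m -> finsupp n ->
  smul (smono K m) (smono K n) = smono K (monoD m n).
Proof.
move=> Hm Hn; apply/funext => k.
(* With error 0 the single pair [(m, n)] gives the product exactly. *)
have := @smul_approx _ _ [:: (m, n)] 0 k (tate_smono Hm) (tate_smono Hn) isT (lexx 0).
have -> : \sum_(p <- [:: (m, n)] | monoD p.1 p.2 == k) smono K m p.1 * smono K n p.2
    = if monoD m n == k then 1 else 0.
  by rewrite big_mkcond big_seq1 /= /smono !asboolT // mulr1.
move=> H.
apply/eqP; rewrite -subr_eq0; apply/eqP/(abs_eq0 absna)/eqP.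
rewrite eq_le abs_ge0 // andbT.
have -> : smono K (monoD m n) k = if monoD m n == k then 1 else 0.
  by rewrite /smono; case: asboolP => [->|nk]; [rewrite eqxx|case: eqP => // /esym].
apply: H => -[i j]; rewrite inE /smono /= => np _.
case: asboolP => [im|_]; last by rewrite mul0r abs0.
case: asboolP => [jn|_]; last by rewrite mulr0 abs0.
by move: np; rewrite im jn eqxx.
Qed.

Lemma smul_saddr f g h : tate abs f -> tate abs g -> tate abs h ->
  smul f (sadd g h) = sadd (smul f g) (smul f h).
Proof.
move=> tf tg th; apply/funext => k; rewrite /sadd.
have [fk|nk] := pselect (finsupp k); last first.
  by rewrite !smul_nfinsupp ?addr0 //; apply: tate_sadd.
rewrite /smul -fsbig_split //=; last exact: finite_antidiagonal.
by apply: eq_fsbigr => p _; rewrite mulrDr.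
Qed.

Lemma smul_sscaler c f g : tate abs f -> tate abs g ->
  smul f (sscale c g) = sscale c (smul f g).
Proof.
move=> tf tg; apply/funext => k; rewrite /sscale.
have [fk|nk] := pselect (finsupp k); last first.
  by rewrite !smul_nfinsupp ?mulr0 //; apply: tate_sscale.
rewrite /smul !fsbig_finite //=; try exact: finite_antidiagonal.
by rewrite mulr_sumr; apply: eq_bigr => p _; rewrite mulrCA.
Qed.

Lemma smul_sscalel c f g : tate abs f -> tate abs g ->
  smul (sscale c f) g = sscale c (smul f g).
Proof.
move=> tf tg; apply/funext => k; rewrite /sscale.
have [fk|nk] := pselect (finsupp k); last first.
  by rewrite !smul_nfinsupp ?mulr0 //; apply: tate_sscale.
rewrite /smul !fsbig_finite //=; try exact: finite_antidiagonal.
by rewrite mulr_sumr; apply: eq_bigr => p _; rewrite mulrA.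
Qed.

Hypothesis cpl : abs_complete abs.

Section Evaluation.
Variable w : mono -> K.
Hypotheses (w_le1 : forall i, abs (w i) <= 1)
  (wD : forall i j, finsupp i -> finsupp j -> w (monoD i j) = w i * w j).

(* l is the sum of the f i * w i over the net of finite sets of indices, with the
   ultrametric error bound. *)
Let is_ev (f : mono -> K) (l : K) := forall e s, 0 < e -> uniq s ->
  (forall i, i \notin s -> abs (f i) <= e) -> abs (l - \sum_(i <- s) f i * w i) <= e.

Definition ev (f : mono -> K) : K := xget 0 [set l | is_ev f l].

Let term_le f i e : abs (f i) <= e -> abs (f i * w i) <= e.
Proof. by move=> H; rewrite mulrC; apply: absM_le. Qed.

(** Partial sums that leave out only coefficients of norm at most [1 / (n + 1)] converge, so the
    default 0 of [ev] is never met on Tate series. *)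
Lemma evP f : tate abs f -> is_ev f (ev f).
Proof.
move=> tf; apply: (xgetPex 0 (P := [set l | is_ev f l])).
have Hn (n : nat) : exists s, uniq s /\ forall i, i \notin s -> abs (f i) <= n.+1%:R^-1.
  have [|s [_ [us Hs _]]] := tate_approx (e := n.+1%:R^-1) tf; first by rewrite invr_gt0.
  by exists s; split=> // i /Hs /ltW.
have [s Hs] := choice Hn.
pose u n := \sum_(i <- s n) f i * w i.
have close e s' n : 0 < e -> uniq s' -> (forall i, i \notin s' -> abs (f i) <= e) ->
    n.+1%:R^-1 <= e -> abs (u n - \sum_(i <- s') f i * w i) <= e.
  move=> e0 us' Hs' ne; have [us H] := Hs n; apply: sum_approx => //.
  - exact: ltW.
  - by move=> i /H Hi; apply/term_le/(le_trans Hi).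
  - by move=> i /Hs' Hi; apply/term_le.
have [l Hl] : exists l, forall e, 0 < e -> exists N, forall n, (N <= n)%N -> abs (u n - l) < e.
  apply: cauchy_succ => // e e0; have [N HN] := inv_small e0.
  exists N => n Nn; apply: (le_lt_trans _ (HN n Nn)).
  have n1 : n.+2%:R^-1 <= n.+1%:R^-1 :> R by rewrite lef_pV2 ?posrE ?ltr0n // ler_nat.
  by apply: close => //; [rewrite invr_gt0|case: (Hs n)|case: (Hs n)].
exists l => /= e s' e0 us' Hs'.
apply: (lim_dist_le absna _ Hl); first exact: ltW.
have [N HN] := inv_small e0; exists N => n Nn; apply: close => //; exact/ltW/HN.
Qed.

(** Adds the error [e = 0] to the defining property, which makes the evaluation of a finite sum
    exact. *)
Lemma ev_approx f e s : tate abs f -> 0 <= e -> uniq s ->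
  (forall i, i \notin s -> abs (f i) <= e) -> abs (ev f - \sum_(i <- s) f i * w i) <= e.
Proof.
move=> tf e0 us H; apply/ler_addgt0Pr => d d0; apply: evP => //.
  by rewrite ltr_wpDl.
by move=> i /H Hi; apply: (le_trans Hi); rewrite lerDl ltW.
Qed.

Lemma ev_le f B : tate abs f -> 0 <= B -> (forall i, abs (f i) <= B) -> abs (ev f) <= B.
Proof.
move=> tf B0 H; have := @ev_approx f B [::] tf B0 isT; rewrite big_nil subr0.
by apply => i _.
Qed.

Lemma ev_smono m : finsupp m -> ev (smono K m) = w m.
Proof.
move=> Hm; apply: (abs_eq_le absna) => e e0.
have := @ev_approx _ 0 [:: m] (tate_smono Hm) (lexx 0) isT.
rewrite big_seq1; have -> : smono K m m = 1 by rewrite /smono asboolT.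
rewrite mul1r => H; apply: le_trans (ltW e0); apply: H.
move=> i; rewrite inE /smono; case: asboolP => [->|_ _]; first by rewrite eqxx.
by rewrite abs0.
Qed.

Lemma ev_sadd f g : tate abs f -> tate abs g -> ev (sadd f g) = ev f + ev g.
Proof.
move=> tf tg; apply: (abs_eq_le absna) => e e0.
have [s [_ [us Hs _]]] := tate_approx tf e0.
have [s' [_ [us' Hs' _]]] := tate_approx tg e0.
pose S := undup (s ++ s').
have uS : uniq S by apply: undup_uniq.
have HS i : i \notin S -> abs (f i) <= e /\ abs (g i) <= e.
  rewrite mem_undup mem_cat negb_or => /andP[/Hs fi /Hs' gi].
  by split; apply: ltW.
apply: (@abs_trans_le _ _ _ absna _ (\sum_(i <- S) sadd f g i * w i)).
  apply: ev_approx => //; [exact: tate_sadd|exact: ltW|].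
  by move=> i /HS[fi gi]; apply: absD_le.
have -> : \sum_(i <- S) sadd f g i * w i
    = \sum_(i <- S) f i * w i + \sum_(i <- S) g i * w i.
  by rewrite -big_split; apply: eq_bigr => i _; rewrite /sadd mulrDl.
rewrite opprD addrACA; apply: absD_le => //; rewrite absBC //; apply: ev_approx => //.
- exact: ltW.
- by move=> i /HS[].
- exact: ltW.
- by move=> i /HS[].
Qed.

Lemma ev_sscale c f : tate abs f -> ev (sscale c f) = c * ev f.
Proof.
move=> tf; apply: (abs_eq_le absna) => e e0.
have c0 : 0 < abs c + 1 by rewrite ltr_wpDl // abs_ge0.
have d0 : 0 < e / (abs c + 1) by rewrite divr_gt0.
have cd x : abs x <= e / (abs c + 1) -> abs (c * x) <= e.
  move=> H; rewrite absM //.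
  apply: (@le_trans _ _ ((abs c + 1) * (e / (abs c + 1)))); last first.
    by rewrite mulrC divfK // gt_eqF.
  by apply: ler_pM => //; rewrite ?abs_ge0 // lerDl.
have [s [_ [us Hs _]]] := tate_approx tf d0.
apply: (@abs_trans_le _ _ _ absna _ (\sum_(i <- s) sscale c f i * w i)).
  apply: ev_approx => //; [exact: tate_sscale|exact: ltW|].
  by move=> i /Hs /ltW; apply: cd.
have -> : \sum_(i <- s) sscale c f i * w i = c * \sum_(i <- s) f i * w i.
  by rewrite mulr_sumr; apply: eq_bigr => i _; rewrite mulrA.
rewrite -mulrBr; apply: cd; rewrite absBC //; apply: ev_approx => //.
  exact: ltW.
by move=> i /Hs /ltW.
Qed.

(** Both sides are within [e] of the product of a finite partial sum for [f] and one for [g], which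
    is regrouped by the total exponent [k]. *)
Lemma ev_smul f g : tate abs f -> tate abs g -> ev (smul f g) = ev f * ev g.
Proof.
move=> tf tg; apply: (abs_eq_le absna) => e e0.
have [A A1 HA] := tate_bounded tf; have [B B1 HB] := tate_bounded tg.
have A0 : 0 < A by apply: lt_le_trans A1.
have B0 : 0 < B by apply: lt_le_trans B1.
(* The thresholds [e / B] and [e / A] make a product at most [e] as soon as one factor is a
   discarded coefficient. *)
have [s [n [us Hs bs]]] := tate_approx tf (divr_gt0 e0 B0).
have [s' [n' [us' Hs' bs']]] := tate_approx tg (divr_gt0 e0 A0).
pose P := [seq (i, j) | i <- s, j <- s'].
have uP : uniq P by apply: allpairs_uniq => // -[? ?] [? ?].
have HP p : p \notin P -> abs (f p.1 * g p.2) <= e.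
  move=> pP; have : (p.1 \notin s) || (p.2 \notin s').
    rewrite -negb_and; apply: contra pP => /andP[p1 p2].
    by apply/allpairsP; exists p; split=> //; case: (p).
  rewrite absM // => /orP[/Hs /ltW H|/Hs' /ltW H].
    rewrite -[e](@divfK _ B) ?gt_eqF //; apply: ler_pM; rewrite ?abs_ge0 //.
  rewrite -[e](@divfK _ A) ?gt_eqF // [X in _ <= X]mulrC.
  by apply: ler_pM; rewrite ?abs_ge0.
pose S := undup [seq monoD p.1 p.2 | p <- P].
have e0' := ltW e0.
apply: (@abs_trans_le _ _ _ absna _ (\sum_(k <- S) smul f g k * w k)).
  apply: ev_approx => //; [exact: tate_smul|exact: undup_uniq|].
  move=> k kS; apply: smul_bound => // p pk; apply: HP; apply: contra kS => pP.
  by rewrite mem_undup; apply/mapP; exists p.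
apply: (@abs_trans_le _ _ _ absna _
  (\sum_(k <- S) (\sum_(p <- P | monoD p.1 p.2 == k) f p.1 * g p.2) * w k)).
  rewrite -sumrB; apply: abs_sum_le => // k _ _.
  rewrite -mulrBl mulrC; apply: absM_le => //; apply: smul_approx => // p pP _.
  exact: HP.
have -> : \sum_(k <- S) (\sum_(p <- P | monoD p.1 p.2 == k) f p.1 * g p.2) * w k
    = (\sum_(i <- s) f i * w i) * (\sum_(j <- s') g j * w j).
  transitivity (\sum_(p <- P) f p.1 * w p.1 * (g p.2 * w p.2)); last first.
    by rewrite big_allpairs big_distrlr.
  under eq_bigr do rewrite mulr_suml.
  under eq_bigr do rewrite big_mkcond.
  (* Each pair contributes to exactly one [k] in [S]. *)
  rewrite exchange_big /=; apply: eq_big_seq => p pP.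
  have pS : monoD p.1 p.2 \in S by rewrite mem_undup; apply/mapP; exists p.
  rewrite (bigD1_seq _ pS (undup_uniq _)) /= eqxx big1 => [|k]; last first.
    by rewrite eq_sym => /negbTE ->.
  move: pP => /allpairsP[[i j] /= [si sj ->]] /=.
  rewrite wD ?addr0; [|by exists n; apply: bs|by exists n'; apply: bs'].
  by ring.
have sB : abs (\sum_(j <- s') g j * w j) <= B.
  apply: abs_sum_le => // [|j _ _]; [exact: ltW|exact: term_le].
have -> : (\sum_(i <- s) f i * w i) * (\sum_(j <- s') g j * w j) - ev f * ev g =
  (\sum_(i <- s) f i * w i - ev f) * (\sum_(j <- s') g j * w j)
  + ev f * (\sum_(j <- s') g j * w j - ev g) by ring.
apply: absD_le => //; rewrite absM //.
  rewrite absBC // -[e](@divfK _ B) ?gt_eqF //; apply: ler_pM; rewrite ?abs_ge0 //.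
  apply: ev_approx => //; first by rewrite ltW // divr_gt0.
  by move=> i /Hs /ltW.
rewrite -[e](@divfK _ A) ?gt_eqF // [X in _ <= X]mulrC; apply: ler_pM; rewrite ?abs_ge0 //.
  by apply: ev_le => //; apply: ltW.
rewrite absBC //; apply: ev_approx => //; first by rewrite ltW // divr_gt0.
by move=> i /Hs' /ltW.
Qed.

End Evaluation.
End TateAlgebra.

(** * Reduction modulo the ideal *)

Section Polynomials.
Variables (R : realType) (K : fieldType) (abs : K -> R).
Hypotheses (absna : nonarch_abs abs) (cpl : abs_complete abs).

(** The index type is free: it will be the exponents themselves, with [h = id], or finite tuples of
    exponents. *)
Definition spoly (J : Type) (s : seq J) (c : J -> K) (h : J -> mono) : mono -> K :=
  fun k => \sum_(i <- s) c i * smono K (h i) k.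

Lemma spoly_cons (J : Type) i (s : seq J) c h :
  spoly (i :: s) c h = sadd (sscale (c i) (smono K (h i))) (spoly s c h).
Proof. by apply/funext => k; rewrite /spoly big_cons. Qed.

Lemma spoly_nil (J : Type) c h : spoly (Nil J) c h = @szero K.
Proof. by apply/funext => k; rewrite /spoly big_nil. Qed.

Lemma tate_spoly (J : Type) (s : seq J) c h : (forall i, finsupp (h i)) ->
  tate abs (spoly s c h).
Proof.
move=> Hh; elim: s => [|i s IH]; first by rewrite spoly_nil; apply: tate_szero.
by rewrite spoly_cons; apply: tate_sadd => //; apply: tate_sscale => //; apply: tate_smono.
Qed.

Lemma spoly_id s (f : mono -> K) k : uniq s ->
  spoly s f id k = if k \in s then f k else 0.
Proof.
move=> us; rewrite /spoly; have [ks|ks] := boolP (k \in s).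
  rewrite (bigD1_seq k) //= /smono asboolT // mulr1 big1 ?addr0 // => i ik.
  by case: asboolP => [ki|_]; [rewrite ki eqxx in ik|rewrite mulr0].
rewrite big1_seq // => i /andP[_ si]; rewrite /smono.
by case: asboolP => [ki|_]; [rewrite ki si in ks|rewrite mulr0].
Qed.

Section EvPoly.
Variable w : mono -> K.
Hypothesis w_le1 : forall i, abs (w i) <= 1.

Lemma ev_szero : ev abs w (@szero K) = 0.
Proof.
have := ev_sscale absna cpl w_le1 0 (tate_szero absna); rewrite mul0r.
by rewrite (_ : sscale 0 _ = @szero K) //; apply/funext => k; apply: mul0r.
Qed.

Lemma ev_spoly (J : Type) (s : seq J) c h : (forall i, finsupp (h i)) ->
  ev abs w (spoly s c h) = \sum_(i <- s) c i * w (h i).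
Proof.
move=> Hh; elim: s => [|i s IH]; first by rewrite spoly_nil big_nil ev_szero.
have ti := tate_smono absna (Hh i).
rewrite spoly_cons big_cons ev_sadd //; [|exact: tate_sscale|exact: tate_spoly].
by rewrite IH ev_sscale // ev_smono.
Qed.

Lemma ev_dist f g B : tate abs f -> tate abs g -> 0 <= B ->
  (forall i, abs (f i - g i) <= B) -> abs (ev abs w f - ev abs w g) <= B.
Proof.
move=> tf tg B0 H.
have -> : ev abs w f - ev abs w g = ev abs w (sadd f (sscale (-1) g)).
  by rewrite ev_sadd //; [rewrite ev_sscale // mulN1r|exact: tate_sscale].
apply: ev_le => // [|i]; first by apply: tate_sadd => //; apply: tate_sscale.
by rewrite /sadd /sscale mulN1r.
Qed.

End EvPoly.

(** The exponent of [X_j^c]. *)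
Definition delta_mono (c j : nat) : mono := fun k => (c * (k == j))%N.

Lemma delta_mono_bounded c j : mono_bounded j.+1 (delta_mono c j).
Proof. by move=> k jk; rewrite /delta_mono gtn_eqF // muln0. Qed.

Lemma finsupp_delta c j : finsupp (delta_mono c j).
Proof. by exists j.+1; apply: delta_mono_bounded. Qed.

Lemma svarE j : svar K j = smono K (delta_mono 1 j).
Proof. by congr smono; apply/funext => k; rewrite /delta_mono mul1n. Qed.

Lemma iter_svarE q j : iter q (smul (svar K j)) (@sone K) = smono K (delta_mono q j).
Proof.
elim: q => [|q IH]; first by congr smono; apply/funext => k; rewrite /delta_mono mul0n.
rewrite iterS IH svarE (smul_smono absna (finsupp_delta 1 j) (finsupp_delta q j)).
by congr smono; apply/funext => k; rewrite /monoD /delta_mono -mulnDl add1n.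
Qed.

Lemma gen_qE q j : gen_q K q j =
  sadd (smono K (delta_mono q j)) (sscale (-1) (smono K (delta_mono 1 j))).
Proof. by rewrite /gen_q iter_svarE svarE. Qed.

Lemma tate_gen_q q j : tate abs (gen_q K q j).
Proof.
rewrite gen_qE; apply: tate_sadd => //; last apply: tate_sscale => //;
by apply: tate_smono => //; apply: finsupp_delta.
Qed.

Lemma gen_ideal_szero q : gen_ideal abs q (@szero K).
Proof. by exists 0%N, (fun=> @szero K), (fun=> 0%N); split=> //; rewrite big_ord0. Qed.

Lemma gen_ideal_cons q h j f : tate abs h -> gen_ideal abs q f ->
  gen_ideal abs q (sadd (smul h (gen_q K q j)) f).
Proof.
move=> th [n [hs [js [ths ->]]]].
exists n.+1, (fun k => if k is k'.+1 then hs k' else h),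
  (fun k => if k is k'.+1 then js k' else j); split.
  by case=> // k /ths.
by rewrite big_ord_recl.
Qed.

Lemma gen_ideal_ind q (P : (mono -> K) -> Prop) : P (@szero K) ->
  (forall h j f, tate abs h -> P f -> P (sadd (smul h (gen_q K q j)) f)) ->
  forall f, gen_ideal abs q f -> P f.
Proof.
move=> P0 PS f [n [h [js [th ->]]]]; elim: n h js th => [|n IH] h js th.
  by rewrite big_ord0.
rewrite big_ord_recl; apply: PS; first exact: th.
by apply: (IH (fun k => h k.+1) (fun k => js k.+1)) => k kn; apply: th.
Qed.

Lemma gen_ideal_tate q f : gen_ideal abs q f -> tate abs f.
Proof.
move: f; apply: gen_ideal_ind => [|h j f th tf]; first exact: tate_szero.
by apply: tate_sadd => //; apply: tate_smul => //; apply: tate_gen_q.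
Qed.

Variable q : nat.
Hypothesis q1 : (1 < q)%N.

Definition reduced_mono (i : mono) := forall k, (i k < q)%N.

Definition reduced (p : mono -> K) := forall i, ~ reduced_mono i -> p i = 0.

Lemma sum_delta_mono n c j : (j < n)%N -> (\sum_(k < n) delta_mono c j k = c)%N.
Proof.
move=> jn; rewrite (bigD1 (Ordinal jn)) //= /delta_mono eqxx muln1 big1 ?addn0 // => k.
by rewrite -val_eqE /= => /negbTE ->; rewrite muln0.
Qed.

(* Replacing X_j^q by X_j strictly lowers the total degree. *)
Lemma smono_reduce N n m c g : mono_bounded n m -> (\sum_(k < n) m k < N)%N ->
  gen_ideal abs q g -> exists m', [/\ finsupp m', reduced_mono m' &
    gen_ideal abs q (fun k => g k + c * (smono K m k - smono K m' k))].
Proof.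
elim: N m g => // N IH m g bm sN gI.
have [[j jq]|nred] := pselect (exists j, q <= m j)%N; last first.
  exists m; split; [by exists n| |].
    by move=> k; rewrite ltnNge; apply/negP => kq; apply: nred; exists k.
  by rewrite (_ : (fun k => _) = g) //; apply/funext => k; rewrite subrr mulr0 addr0.
have jn : (j < n)%N.
  by rewrite ltnNge; apply/negP => /bm mj; rewrite mj leqNgt (ltnW q1) in jq.
pose m1 : mono := fun k => (m k - delta_mono q j k)%N.
have mE : m = monoD m1 (delta_mono q j).
  apply/funext => k; rewrite /monoD /m1 subnK // /delta_mono.
  by case: eqP => [->|_]; rewrite ?muln1 ?muln0.
have bm1 : mono_bounded n m1 by move=> k /bm mk; rewrite /m1 mk.
pose m2 := monoD m1 (delta_mono 1 j).
have bm2 : mono_bounded n m2.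
  move=> k nk; rewrite /m2 /monoD bm1 // /delta_mono gtn_eqF ?muln0 //.
  exact: leq_trans nk.
have sum_m1 a : (\sum_(k < n) monoD m1 (delta_mono a j) k = \sum_(k < n) m1 k + a)%N.
  by rewrite big_split /= sum_delta_mono.
(* Passing from [m] to [m2] lowers the degree by [q - 1], which is positive by [q1]. *)
have sm2 : (\sum_(k < n) m2 k < N)%N by move: sN; rewrite mE !sum_m1; lia.
have fm1 : finsupp m1 by exists n.
have tm1 := tate_smono absna fm1.
(* [h] times [X_j^q - X_j] is [c] times the difference of the monomials [m] and [m2]; it is absorbed
   into the accumulated element [g]. *)
pose h := sscale c (smono K m1).
have th : tate abs h by apply: tate_sscale.
have [m' [fm' rm' gm']] := IH m2 _ bm2 sm2 (gen_ideal_cons j th gI).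
exists m'; split=> //; move: gm'; congr gen_ideal; apply/funext => k.
have td a := tate_smono absna (finsupp_delta a j).
rewrite gen_qE (smul_saddr absna) //; last exact: tate_sscale.
rewrite (smul_sscaler absna) // /h !(smul_sscalel absna) // !(smul_smono absna) //; try exact: finsupp_delta.
by rewrite -mE -/m2 /sadd /sscale; ring.
Qed.

Lemma spoly_reduce (s : seq mono) (f : mono -> K) : (forall i, i \in s -> finsupp i) ->
  exists g p, [/\ gen_ideal abs q g, tate abs p, reduced p & spoly s f id = sadd g p].
Proof.
elim: s => [|m s IH] fs.
  exists (@szero K), (@szero K); split=> //; first exact: gen_ideal_szero.
    exact: tate_szero.
  by rewrite spoly_nil; apply/funext => k; rewrite /sadd addr0.
have [|g [p [gI tp rp E]]] := IH; first by move=> i si; apply: fs; rewrite inE si orbT.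
have [n bn] : finsupp m by apply: fs; rewrite inE eqxx.
have [m' [fm' rm' gI']] := smono_reduce (f m) bn (ltnSn _) gI.
eexists; exists (sadd p (sscale (f m) (smono K m'))); split; first exact: gI'.
- by apply: tate_sadd => //; apply: tate_sscale => //; apply: tate_smono.
- move=> i ni; rewrite /sadd rp // /sscale /smono.
  by case: asboolP => [im|_]; [case: ni; rewrite im|rewrite mulr0 addr0].
- rewrite spoly_cons E; apply/funext => k; rewrite /sadd /sscale; by ring.
Qed.

(** [f] is truncated to finitely many monomials at the cost of an error [e], and each of these is
    reduced modulo the ideal. *)
Lemma tate_reduce f e : tate abs f -> 0 < e -> exists g p,
  [/\ gen_ideal abs q g, tate abs p, reduced p & forall k, abs (f k - sadd g p k) <= e].
Proof.
move=> tf e0; have [s [n [us Hs bs]]] := tate_approx absna tf e0.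
have [|g [p [gI tp rp E]]] := @spoly_reduce s f; first by move=> i /bs bi; exists n.
exists g, p; split=> // k; rewrite -E spoly_id //.
case: ifPn => [_|/Hs /ltW]; last by rewrite subr0.
by rewrite subrr abs0 // ltW.
Qed.

End Polynomials.

(** * The isomorphism *)

Section Isomorphism.
Variables (R : realType) (K : fieldType) (abs : K -> R).
Hypotheses (absna : nonarch_abs abs) (cpl : abs_complete abs).
Variable pi : K.
Hypotheses (pi0 : pi != 0) (pi1 : abs pi < 1)
  (pi_max : forall x, abs x < 1 -> abs x <= abs pi).
Variables (q : nat) (t : 'I_q -> K) (rd : K -> 'I_q).
Hypotheses (q1 : (1 < q)%N) (t_root : forall i, t i ^+ q = t i)
  (t_le1 : forall i, abs (t i) <= 1)
  (t_inj : forall i j, abs (t i - t j) < 1 -> i = j)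
  (rdP : forall x, abs x <= 1 -> abs (x - t (rd x)) < 1).

Local Notation dig := (dig pi t rd).
Local Notation mon := (mon pi t rd).

Definition Phi (f : mono -> K) (x : K) : K := ev abs (mon x) f.

Let w_le1 x : forall i, abs (mon x i) <= 1.
Proof. exact: mon_le1. Qed.

Let wD x i j : finsupp i -> finsupp j -> mon x (monoD i j) = mon x i * mon x j.
Proof. exact: monD. Qed.

(** Up to [e / 2] the series is a polynomial in [n] variables, whose value depends on [n] digits
    only and so is constant on balls of radius [abs pi ^+ n]. *)
Lemma Phi_contO f : tate abs f -> contO abs (Phi f).
Proof.
move=> tf x x1 e e0.
have e20 : 0 < e / 2 by rewrite divr_gt0.
have [s [n [us Hs bs]]] := tate_approx absna tf e20.
exists (abs pi ^+ n) => [|y y1 /ltW yx]; first by rewrite exprn_gt0 // abs_pi_gt0.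
have Ey : \sum_(i <- s) f i * mon y i = \sum_(i <- s) f i * mon x i.
  apply: eq_big_seq => i /bs bi; congr (_ * _); apply: (mon_agree bi).
  exact: (dig_agree absna pi0 pi1 pi_max t_inj rdP y1 x1 yx).
apply: (@le_lt_trans _ _ (e / 2)); last by lra.
have near z : abs (Phi f z - \sum_(i <- s) f i * mon z i) <= e / 2.
  by apply: ev_approx => //; [exact: ltW|move=> i /Hs /ltW].
apply: (abs_trans_le absna (near y)); rewrite absBC // Ey; exact: near.
Qed.

Lemma mon_delta x c j : mon x (delta_mono c j) = t (dig j x) ^+ c.
Proof.
rewrite (monE _ _ _ _ (@delta_mono_bounded c j)) big_ord_recr /= big1 => [|k _].
  by rewrite mul1r /delta_mono eqxx muln1.
by rewrite /delta_mono ltn_eqF // muln0 expr0.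
Qed.

Lemma Phi_gen_ideal f x : gen_ideal abs q f -> Phi f x = 0.
Proof.
have tg := tate_gen_q absna q.
move=> fI; suff [] : tate abs f /\ Phi f x = 0 by [].
move: f fI; apply: gen_ideal_ind => [|h j f th [tf f0]].
  by split; [exact: tate_szero|exact: ev_szero].
have th' := tate_smul absna th (tg j).
split; first exact: tate_sadd.
rewrite /Phi ev_sadd // -/(Phi f x) f0 addr0 (ev_smul absna cpl (w_le1 x) (wD x) th (tg j)) (gen_qE absna).
have td a := tate_smono absna (finsupp_delta a j).
rewrite ev_sadd //; last exact: tate_sscale.
rewrite ev_sscale // !ev_smono //; try exact: finsupp_delta.
by rewrite !mon_delta t_root expr1 mulN1r subrr mulr0.
Qed.

(** * The Vandermonde matrix of the Teichmueller representatives *)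

Let V : 'M[K]_q := Vandermonde q (\row_i t i).
Let L : 'M[K]_q := invmx V.

Let V_entry k i : V k i = t i ^+ k.
Proof. by rewrite !mxE. Qed.

Let V_le1 k i : abs (V k i) <= 1.
Proof. by rewrite V_entry; apply: absX_le1. Qed.

(** The determinant is a product of differences of distinct representatives, none of which has norm
    below 1. *)
Let V_det : abs (\det V) = 1.
Proof.
rewrite det_Vandermonde abs_prod // big1 // => i _; rewrite abs_prod // big1 // => j ij.
rewrite !mxE; apply/eqP; rewrite eq_le absB_le //= leNgt.
by apply/negP => /t_inj ji; rewrite ji ltnn in ij.
Qed.

Let V_unit : V \in unitmx.
Proof.
rewrite unitmxE unitfE; apply/eqP => d0; have := V_det.
by rewrite d0 abs0 // => /eqP; rewrite eq_sym oner_eq0.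
Qed.

Let L_le1 i k : abs (L i k) <= 1.
Proof. exact: abs_invmx_le1. Qed.

Let VL (k l : 'I_q) : \sum_i L i l * t i ^+ k = (k == l)%:R.
Proof.
have := congr1 (fun A : 'M_q => A k l) (mulmxV V_unit); rewrite !mxE => <-.
by apply: eq_bigr => i _; rewrite mulrC -V_entry.
Qed.

Let LV (i j : 'I_q) : \sum_(k < q) L i k * t j ^+ k = (i == j)%:R.
Proof.
have := congr1 (fun A : 'M_q => A i j) (mulVmx V_unit); rewrite !mxE => <-.
by apply: eq_bigr => k _; rewrite -V_entry.
Qed.

Section FixedLevel.
Variable n : nat.
Local Notation tup := {ffun 'I_n -> 'I_q}.

(* tau stands for a point of T^n, m for a reduced exponent. *)
Let tpow (tau m : tup) : K := \prod_j t (tau j) ^+ m j.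
Let tdual (tau m : tup) : K := \prod_j L (tau j) (m j).

Let prod_delta (a b : tup) : \prod_j (a j == b j)%:R = (a == b)%:R :> K.
Proof.
have [->|ab] := eqVneq a b; first by rewrite big1 // => j _; rewrite eqxx.
have [j jab] : exists j, a j != b j.
  apply/existsP; apply: contraNT ab => /existsPn H; apply/eqP/ffunP => j.
  by apply/eqP; have := H j; rewrite negbK.
by rewrite (bigD1 j) //= (negbTE jab) mul0r.
Qed.

(** Expanding the product over [j] of the one-variable identities [VL]. This direction recovers
    coefficients from values; [tpow_dual], from [LV], is the one that interpolates. *)
Let tdual_pow (m l : tup) : \sum_tau tdual tau l * tpow tau m = (m == l)%:R.
Proof.
rewrite -prod_delta; under [RHS]eq_bigr => j _ do rewrite -VL.
rewrite bigA_distr_bigA /=; apply: eq_bigr => tau _.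
by rewrite /tdual /tpow -big_split.
Qed.

Let tpow_dual (a b : tup) : \sum_m tdual a m * tpow b m = (a == b)%:R.
Proof.
rewrite -prod_delta; under [RHS]eq_bigr => j _ do rewrite -LV.
rewrite bigA_distr_bigA /=; apply: eq_bigr => m _.
by rewrite /tdual /tpow -big_split.
Qed.

Let tdual_le1 a m : abs (tdual a m) <= 1.
Proof. by apply: abs_prod_le1. Qed.

Let emb (m : tup) : mono := ord_mono (fun o => nat_of_ord (m o)).

Let emb_inj : injective emb.
Proof.
move=> a b ab; apply/ffunP => j; apply: val_inj.
by have := congr1 (fun f : mono => f j) ab; rewrite /emb !ord_mono_ord.
Qed.

Let emb_bounded m : mono_bounded n (emb m).
Proof. exact: ord_mono_bounded. Qed.

Let emb_finsupp m : finsupp (emb m).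
Proof. exists n; exact: emb_bounded. Qed.

Let emb_reduced m : reduced_mono q (emb m).
Proof.
move=> k; have [kn|nk] := ltnP k n; last by rewrite (emb_bounded m nk) ltnW.
by rewrite /emb (ord_mono_ord _ (Ordinal kn)).
Qed.

Let emb_surj i : mono_bounded n i -> reduced_mono q i -> exists m, i = emb m.
Proof.
move=> bi ri; exists [ffun o : 'I_n => Ordinal (ri o)].
rewrite -[LHS](ord_monoE bi); congr ord_mono; apply/funext => o; by rewrite ffunE.
Qed.

Let digs x : tup := [ffun j : 'I_n => dig j x].

Let mon_emb x m : mon x (emb m) = tpow (digs x) m.
Proof.
rewrite (monE _ _ _ _ (emb_bounded m)); apply: eq_bigr => j _.
by rewrite ffunE /emb ord_mono_ord.
Qed.

Let digs_exist (tau : tup) : exists x, abs x <= 1 /\ digs x = tau.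
Proof.
have i0 : 'I_q by exists 0%N; apply: ltnW.
pose tau' j := if insub j is Some o then tau o else i0.
have [x x1 Hx] := dig_exist absna pi0 pi1 t_le1 t_inj rdP n tau'.
by exists x; split=> //; apply/ffunP => j; rewrite ffunE Hx // /tau' valK.
Qed.

(** The coefficients are combinations of the values on digit tuples with weights [tdual] of norm at
    most 1; [e] absorbs the terms in which variables beyond the first [n] occur. *)
Lemma reduced_coef_le p e M : tate abs p -> reduced q p -> 0 < e -> 0 <= M ->
  (forall i, ~ mono_bounded n i -> abs (p i) <= e) ->
  (forall x, abs x <= 1 -> abs (Phi p x) <= M) ->
  forall i, abs (p i) <= Num.max M e.
Proof.
move=> tp rp e0 M0 Hp HM i.
have [bi|nbi] := pselect (mono_bounded n i); last by rewrite le_max Hp // orbT.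
have [ri|nri] := pselect (reduced_mono q i); last first.
  by rewrite rp // abs0 // le_max M0.
have [l ->] := emb_surj bi ri.
have max0 : 0 <= Num.max M e by rewrite le_max M0.
(* Every tuple is the digit tuple of some [x] in O, where the truncated polynomial differs from
   [Phi p x] by at most [e]. *)
have bnd tau : abs (\sum_m p (emb m) * tpow tau m) <= Num.max M e.
  have [x [x1 <-]] := digs_exist tau.
  pose s := map emb (index_enum tup).
  have -> : \sum_m p (emb m) * tpow (digs x) m = \sum_(i <- s) p i * mon x i.
    by rewrite big_map; apply: eq_bigr => m _; rewrite mon_emb.
  apply: (@abs_near_le _ _ _ absna _ _ (Phi p x)); last first.
    by rewrite le_max HM.
  rewrite absBC //; apply: ev_approx => //.
    by rewrite map_inj_uniq // index_enum_uniq.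
  move=> k ks; have [bk|/Hp pk] := pselect (mono_bounded n k); last first.
    by rewrite le_max pk orbT.
  have [rk|nrk] := pselect (reduced_mono q k); last by rewrite rp // abs0 //.
  by have [m km] := emb_surj bk rk; rewrite km map_f ?mem_index_enum in ks.
have -> : p (emb l) = \sum_tau tdual tau l * \sum_m p (emb m) * tpow tau m.
  under eq_bigr do rewrite mulr_sumr.
  rewrite exchange_big /= (bigD1 l) //=.
  under eq_bigr do rewrite mulrCA.
  rewrite -mulr_sumr tdual_pow eqxx mulr1 big1 ?addr0 // => m ml.
  under eq_bigr do rewrite mulrCA.
  by rewrite -mulr_sumr tdual_pow (negbTE ml) mulr0.
by apply: abs_sum_le => // tau _ _; apply: absM_le.
Qed.

(** One sample point [xs tau] is chosen per digit tuple and [g] is interpolated there; then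
    [Phi p x] is the value of [g] at a point sharing its first [n] digits with [x]. *)
Lemma reduced_interp g e : 
  (forall x y, abs x <= 1 -> abs y <= 1 ->
    (forall k, (k < n)%N -> dig k x = dig k y) -> abs (g x - g y) < e) ->
  exists p, [/\ tate abs p, reduced q p & forall x, abs x <= 1 -> abs (Phi p x - g x) <= e].
Proof.
move=> Hg; have [xs Hxs] := choice digs_exist.
pose c m := \sum_tau g (xs tau) * tdual tau m.
exists (spoly (index_enum tup) c emb); split; first exact: tate_spoly.
  move=> i ni; rewrite /spoly big1 // => m _; rewrite /smono.
  by case: asboolP => [im|_]; [case: ni; rewrite im|rewrite mulr0].
move=> x x1; rewrite /Phi ev_spoly //.
have -> : \sum_m c m * mon x (emb m) = g (xs (digs x)).
  under eq_bigr => m _ do rewrite mon_emb mulr_suml.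
  rewrite exchange_big /= (bigD1 (digs x)) //=.
  under eq_bigr do rewrite -mulrA.
  rewrite -mulr_sumr tpow_dual eqxx mulr1 big1 ?addr0 // => tau ne.
  under eq_bigr do rewrite -mulrA.
  by rewrite -mulr_sumr tpow_dual (negbTE ne) mulr0.
have [xs1 Dxs] := Hxs (digs x).
apply/ltW/Hg => // k kn.
by have := congr1 (fun f : tup => f (Ordinal kn)) Dxs; rewrite !ffunE.
Qed.

End FixedLevel.

Lemma reduced_le p M : tate abs p -> reduced q p -> 0 <= M ->
  (forall x, abs x <= 1 -> abs (Phi p x) <= M) -> forall i, abs (p i) <= M.
Proof.
move=> tp rp M0 HM i; apply/ler_addgt0Pr => e e0.
have [s [n [us Hs bs]]] := tate_approx absna tp e0.
apply: (@le_trans _ _ (Num.max M e)); last first.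
  by rewrite ge_max lerDl lerDr M0 ltW.
apply: (@reduced_coef_le n) => // k nk; apply/ltW/Hs.
by apply/negP => /bs.
Qed.

Lemma Phi_dist f g B x : tate abs f -> tate abs g -> 0 <= B ->
  (forall i, abs (f i - g i) <= B) -> abs (Phi f x - Phi g x) <= B.
Proof. exact: ev_dist. Qed.

Lemma Phi_sub f g x : tate abs f -> tate abs g ->
  Phi (sadd f (sscale (-1) g)) x = Phi f x - Phi g x.
Proof.
by move=> tf tg; rewrite /Phi ev_sadd //; [rewrite ev_sscale // mulN1r|exact: tate_sscale].
Qed.

Lemma tate_sub f g : tate abs f -> tate abs g -> tate abs (sadd f (sscale (-1) g)).
Proof. by move=> tf tg; apply: tate_sadd => //; apply: tate_sscale. Qed.

Lemma sub_coef (f g : mono -> K) i : sadd f (sscale (-1) g) i = f i - g i.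
Proof. by rewrite /sadd /sscale mulN1r. Qed.

(** Reduced approximants [p n] with images converging uniformly to [g] are Cauchy coefficientwise,
    uniformly in the index, by [reduced_le] applied to their differences; the limit coefficients
    give the preimage. *)
Lemma Phi_surj g : contO abs g ->
  exists2 f, tate abs f & forall x, abs x <= 1 -> Phi f x = g x.
Proof.
move=> cg.
have inv0 n : 0 < n.+1%:R^-1 :> R by rewrite invr_gt0.
have Hp (n : nat) : exists p, [/\ tate abs p, reduced q p &
    forall x, abs x <= 1 -> abs (Phi p x - g x) <= n.+1%:R^-1].
  have [N HN] := contO_uniform absna cpl pi0 pi1 pi_max t_le1 rdP cg (inv0 n).
  exact: (reduced_interp HN).
have [p {}Hp] := choice Hp.
have pd e m n i : m.+1%:R^-1 <= e -> n.+1%:R^-1 <= e -> abs (p m i - p n i) <= e.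
  move=> me ne; have [tm rm gm] := Hp m; have [tn rn gn] := Hp n.
  have e0 : 0 <= e by apply: le_trans me; apply: ltW.
  rewrite -sub_coef; apply: reduced_le => // [|k nk|x x1]; first exact: tate_sub.
    by rewrite sub_coef rm // rn // subr0.
  rewrite Phi_sub //; apply: (@abs_trans_le _ _ _ absna _ (g x)).
    exact: (le_trans (gm x x1) me).
  by rewrite absBC //; apply: (le_trans (gn x x1)).
have Ha i : exists l, forall e, 0 < e -> exists N, forall n, (N <= n)%N -> abs (p n i - l) < e.
  apply: cauchy_succ => // e e0; have [N HN] := inv_small e0.
  exists N => n Nn; apply: (le_lt_trans _ (HN n Nn)); apply: pd => //.
  by rewrite lef_pV2 ?posrE ?ltr0n // ler_nat.
have [a {}Ha] := choice Ha.
have ap n i : abs (a i - p n i) <= n.+1%:R^-1.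
  apply: (lim_dist_le absna _ (Ha i)); first exact: ltW.
  by exists n => m nm; apply: pd => //; rewrite lef_pV2 ?posrE ?ltr0n // ler_nat.
have ta : tate abs a.
  split=> [i ni|e e0].
    apply: (abs_eq_le absna) => e e0; have [N HN] := inv_small e0.
    apply: le_trans (ltW (HN N (leqnn N))).
    by have [[z _] _ _] := Hp N; rewrite -(z i ni).
  have [N HN] := inv_small e0; have [[_ pS] _ _] := Hp N.
  (* A coefficient of [a] of norm at least [e] forces the same for [p N], which is closer than [e]
     to [a]. *)
  apply: sub_finite_set (pS e e0) => i /= ei; rewrite leNgt; apply: contraTN ei => pe.
  rewrite -ltNge -(subrK (p N i) (a i)); apply: absD_lt => //.
  by apply: (le_lt_trans (ap N i)); apply: HN.
exists a => // x x1; apply: (abs_eq_le absna) => e e0.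
have [N HN] := inv_small e0; have [tp _ gp] := Hp N.
have Ne := ltW (HN N (leqnn N)).
apply: (@abs_trans_le _ _ _ absna _ (Phi (p N) x)); last exact: le_trans (gp x x1) Ne.
by apply: Phi_dist => // [|i]; [exact: ltW|exact: le_trans (ap N i) Ne].
Qed.

(** Common source of the kernel and of the isometry: modulo the ideal and up to [e], [f] is a
    reduced series, whose coefficients its image controls. *)
Lemma Phi_mod_norm f M e : tate abs f -> 0 <= M -> 0 < e ->
  (forall x, abs x <= 1 -> abs (Phi f x) <= M) ->
  exists2 g, gen_ideal abs q g & forall k, abs (f k - g k) <= Num.max M e.
Proof.
move=> tf M0 e0 HM.
have [g [p [gI tp rp E]]] := tate_reduce absna q1 tf e0.
have tg := gen_ideal_tate absna gI.
have max0 : 0 <= Num.max M e by rewrite le_max M0.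
exists g => // k.
have -> : f k - g k = (f k - sadd g p k) + p k by rewrite /sadd; ring.
apply: absD_le => //; first by rewrite le_max E orbT.
apply: reduced_le => // x x1.
have Pgp : Phi (sadd g p) x = Phi p x.
  by rewrite {1}/Phi ev_sadd // -/(Phi g x) Phi_gen_ideal // add0r.
apply: (@abs_near_le _ _ _ absna _ _ (Phi f x)); last by rewrite le_max HM.
rewrite absBC // -Pgp; apply: Phi_dist => // [|i]; first exact: tate_sadd.
by rewrite le_max E orbT.
Qed.

(** * The Gauss norm, the kernel and the isometry *)

Lemma le_snorm f i : tate abs f -> abs (f i) <= snorm abs f.
Proof.
move=> tf; apply: ub_le_sup; last by exists i.
have [B _ HB] := tate_bounded absna tf.
by exists B => _ [k _ <-].
Qed.

Lemma snorm_le f B : (forall i, abs (f i) <= B) -> snorm abs f <= B.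
Proof.
move=> H; apply: ge_sup; first by exists (abs (f (fun=> 0%N))); exists (fun=> 0%N).
by move=> _ [i _ <-].
Qed.

Lemma snorm_ge0 f : tate abs f -> 0 <= snorm abs f.
Proof. by move=> tf; apply: le_trans (le_snorm (fun=> 0%N) tf); apply: abs_ge0. Qed.

Lemma Phi_le_snorm f x : tate abs f -> abs (Phi f x) <= snorm abs f.
Proof.
by move=> tf; apply: ev_le => // [|i]; [exact: snorm_ge0|exact: le_snorm].
Qed.

(** A vanishing image allows [M = 0] in [Phi_mod_norm], so elements of the ideal come arbitrarily
    close to [f]. Conversely [Phi] kills the ideal and does not increase norms, so it kills the
    closure. *)
Lemma Phi_ker f : tate abs f -> ((forall x, abs x <= 1 -> Phi f x = 0) <-> Iq abs q f).
Proof.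
move=> tf; split=> [H|[_ H] x x1].
  split=> // e e0; have e20 : 0 < e / 2 by rewrite divr_gt0.
  have [|g gI Hg] := Phi_mod_norm tf (lexx 0) e20.
    by move=> x /H ->; rewrite abs0.
  exists g => //; apply: (@le_lt_trans _ _ (e / 2)); last by lra.
  apply: snorm_le => i; rewrite sub_coef; apply: (le_trans (Hg i)).
  by rewrite ge_max lexx ltW.
apply: (abs_eq_le absna) => e e0; have [g gI Hg] := H e e0.
have tg := gen_ideal_tate absna gI.
apply: le_trans (ltW Hg); rewrite -(Phi_gen_ideal x gI) -Phi_sub //.
by apply: Phi_le_snorm; apply: tate_sub.
Qed.

Lemma Phi_le_supO f x : tate abs f -> abs x <= 1 -> abs (Phi f x) <= supO abs (Phi f).
Proof.
move=> tf x1; apply: ub_le_sup; last by exists x.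
by exists (snorm abs f) => _ [y _ <-]; apply: Phi_le_snorm.
Qed.

Lemma Phi_isometry f : tate abs f -> supO abs (Phi f) = resnorm abs (Iq abs q) f.
Proof.
move=> tf; have O1 : intO abs 0 by rewrite /intO /= abs0.
have Itate h : Iq abs q h -> tate abs h by case.
(* First inequality: [f] and [f + h] have the same image for [h] in the closed ideal, and [Phi] does
   not increase norms. *)
apply/eqP; rewrite eq_le; apply/andP; split.
  apply: lb_le_inf.
    exists (snorm abs (sadd f (@szero K))); exists (@szero K) => //.
    apply/Phi_ker => [|x _]; [exact: tate_szero|exact: ev_szero].
  move=> _ [h Ih <-]; have th := Itate h Ih; apply: ge_sup.
    by exists (abs (Phi f 0)); exists 0.
  move=> _ [x x1 <-]; have <- : Phi (sadd f h) x = Phi f x.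
    by rewrite /Phi ev_sadd // -/(Phi h x) (Phi_ker th).2 // addr0.
  by apply: Phi_le_snorm; apply: tate_sadd.
apply/ler_addgt0Pr => e e0.
have M0 : 0 <= supO abs (Phi f).
  by apply: le_trans (Phi_le_supO tf O1); apply: abs_ge0.
(* Second inequality: with the sup norm of the image as [M], the translate of [f] by [-g] has norm
   at most that sup norm plus [e]. *)
have [|g gI Hg] := Phi_mod_norm tf M0 e0; first by move=> x; apply: Phi_le_supO.
have tg := gen_ideal_tate absna gI.
apply: (@le_trans _ _ (snorm abs (sadd f (sscale (-1) g)))).
  apply: ge_inf.
    by exists 0 => _ [h /Itate th <-]; apply/snorm_ge0/tate_sadd.
  exists (sscale (-1) g) => //; apply/Phi_ker => [|x _]; first exact: tate_sscale.
  by rewrite /Phi ev_sscale // -/(Phi g x) Phi_gen_ideal // mulr0.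
apply: snorm_le => i; rewrite sub_coef; apply: (le_trans (Hg i)).
by rewrite ge_max lerDl lerDr M0 ltW.
Qed.

End Isomorphism.

(* An isometric K-Banach-algebra isomorphism K<X>/I_q(K) ~= C(O,K) is given as
   a surjective K-algebra homomorphism Phi from K<X> onto C(O,K) whose kernel is
   I_q(K) and with ||Phi f||_sup = |f mod I_q(K)|. *)
Theorem theorem6p2 (R : realType) (K : fieldType) (abs : K -> R) (q : nat) :
  local_field abs -> residue_card abs q ->
  exists Phi : (mono -> K) -> (K -> K),
    (forall f, tate abs f -> contO abs (Phi f)) /\
    (forall f g, tate abs f -> tate abs g -> forall x, abs x <= 1 ->
        Phi (sadd f g) x = Phi f x + Phi g x) /\
    (forall c f, tate abs f -> forall x, abs x <= 1 ->
        Phi (sscale c f) x = c * Phi f x) /\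
    (forall f g, tate abs f -> tate abs g -> forall x, abs x <= 1 ->
        Phi (smul f g) x = Phi f x * Phi g x) /\
    (forall x, abs x <= 1 -> Phi (@sone K) x = 1) /\
    (forall g, contO abs g ->
        exists2 f, tate abs f & forall x, abs x <= 1 -> Phi f x = g x) /\
    (forall f, tate abs f ->
        ((forall x, abs x <= 1 -> Phi f x = 0) <-> Iq abs q f)) /\
    (forall f, tate abs f -> supO abs (Phi f) = resnorm abs (Iq abs q) f).
Proof.
move=> [absna [[pi [/andP[pi_gt0 pi1] Hpi]] [cpl _]]] resq.
have [t [t_root t_le1 t_inj t_cov]] := teichmuller_system absna cpl resq.
have pi0 : pi != 0 by apply: contraTneq pi_gt0 => ->; rewrite abs0 // ltxx.
have pi_max x : abs x < 1 -> abs x <= abs pi.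
  move=> x1; have [->|xn0] := eqVneq x 0; first by rewrite abs0 // ltW.
  have [n xn] := Hpi x xn0; rewrite xn in x1 *.
  (* Since [abs x < 1], the exponent of [abs pi] is neither zero nor negative, hence at least 1. *)
  case: n x1 {xn} => [[|n]|n] x1; first by rewrite expr0z ltxx in x1.
    by rewrite -[X in _ <= X]expr1; apply: ler_wiXn2l => //; apply: ltW.
  move: x1; rewrite NegzE -exprnN invf_lt1 ?exprn_gt0 // => x1.
  have := le_lt_trans (exprn_ile1 n.+1 (ltW pi_gt0) (ltW pi1)) x1.
  by rewrite ltxx.
have [i0 Hi0] : exists i, abs (0 - t i) < 1 by apply: t_cov; rewrite abs0.
have [i1 Hi1] : exists i, abs (1 - t i) < 1 by apply: t_cov; rewrite abs1.
(* 0 and 1 lie in different residue classes. *)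
have q1 : (1 < q)%N.
  rewrite ltnNge; apply/negP => q_le1.
  have i01 : i0 = i1.
    by apply: val_inj => /=; have := ltn_ord i0; have := ltn_ord i1; lia.
  have : abs (1 - 0) < 1.
    by apply: (abs_trans_lt absna Hi1); rewrite -i01 absBC.
  by rewrite subr0 abs1 // ltxx.
(* Outside O the index [i0] is a default that makes [rd] a total function. *)
have residue x : exists i, abs x <= 1 -> abs (x - t i) < 1.
  have [x1|nx] := pselect (abs x <= 1); last by exists i0.
  by have [i Hi] := t_cov x x1; exists i.
have [rd rdP] := choice residue.
have w1 x i : abs (mon pi t rd x i) <= 1 by apply: mon_le1.
exists (Phi abs pi t rd); split; first by move=> f; apply: Phi_contO.
split; first by move=> f g tf tg x _; apply: ev_sadd.
split; first by move=> c f tf x _; apply: ev_sscale.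
split; first by move=> f g tf tg x _; apply: ev_smul => // i j; apply: monD.
split.
  by move=> x _; rewrite /Phi ev_smono //; [apply: mon0|exists 0%N].
split; first by move=> g; apply: Phi_surj.
split; first by move=> f; apply: Phi_ker.
by move=> f; apply: Phi_isometry.
Qed.
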